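(* Let $\delta\in(0,1)$, $\iota'=\log(3A_{\mathcal X}T/\delta)$ and $\lambda=1+\log_2(1+T)$. Adaptive-FTRL with $\eta=2\sqrt{\iota'T/(\lambda A_{\mathcal X})}$, $\gamma=\sqrt{2\iota'HT/(\lambda A_{\mathcal X})}$ and $\mu^0$ the uniform policy, run against any (possibly adaptive) sequence of opponent policies, satisfies with probability at least $1-\delta$ $$\mathrm{Reg}^T_{\max}\le 6H\sqrt{\iota'\lambda A_{\mathcal X}T}.$$
   Context: Setting. An episodic two-player zero-sum imperfect-information game with horizon $H$ and perfect recall. Max-player information sets $\mathcal X=\bigsqcup_{h=1}^H\mathcal X_h$, action sets $\mathcal A(x)$ of size $A(x)$; each $x_h\in\mathcal X_h$ has a unique history $(x_1,a_1,\dots,x_h)$; $x'\ge x$ means $x'=x$ or $x$ is in the history of $x'$; $\mathcal A(\mathcal X_h)=\{(x_h,a_h)\}$, $A_{\mathcal X}=\sum_xA(x)$. Policies $\mu$ give distributions $\mu_h(\cdot|x_h)$ on $\mathcal A(x_h)$; $\Pi_{\max}$ is the set of policies; $\mu_{1:h}(x_h,a_h)=\prod_{h'\le h}\mu_{h'}(a_{h'}|x_{h'})$ along the history. For a min-player policy $\nu$, $p^\nu_{1:h}(x_h)$ is the probability (induced by the game and $\nu$) that the max-player's information set sequence follows the history of $x_h$ given that the max-player plays the actions of that history, $r^\nu_h(x_h,a_h)\in[0,1]$ the expected reward, and $\ell^\nu_h(x_h,a_h)=p^\nu_{1:h}(x_h)(1-r^\nu_h(x_h,a_h))$; $\langle\mu_{1:},\ell\rangle=\sum_h\sum_{(x_h,a_h)}\mu_{1:h}(x_h,a_h)\ell_h(x_h,a_h)$.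 Protocol: $T$ episodes; $\mu^t,\nu^t$ are $\mathcal F_{t-1}$-measurable ($\mathcal F_t$ generated by the observations of episodes $\le t$ and by $\nu^{t+1}$); in episode $t$, for $h=1..H$, the max-player observes $x^t_h$, plays $a^t_h\sim\mu^t_h(\cdot|x^t_h)$, receives $r^t_h\in[0,1]$, with $\Pr(x^t_h=x_h,a^t_h=a_h|\mathcal F_{t-1})=p^{\nu^t}_{1:h}(x_h)\mu^t_{1:h}(x_h,a_h)$ and $\mathbb E[\mathbb 1\{x^t_h=x_h,a^t_h=a_h\}(1-r^t_h)|\mathcal F_{t-1}]=\mu^t_{1:h}(x_h,a_h)\ell^{\nu^t}_h(x_h,a_h)$. Regret $\mathrm{Reg}^T_{\max}=\max_{\mu^\dagger\in\Pi_{\max}}\sum_t\langle\mu^t_{1:}-\mu^\dagger_{1:},\ell^{\nu^t}\rangle$. Dilated divergence: for positive weights $\eta'=(\eta'_h(x_h))$ and policies $\mu^1,\mu^0$, $D_{\eta'}(\mu^1,\mu^0)=\sum_h\sum_{(x_h,a_h)}\frac{\mu^1_{1:h}(x_h,a_h)}{\eta'_h(x_h)}\log\frac{\mu^1_h(a_h|x_h)}{\mu^0_h(a_h|x_h)}$. Adaptive-FTRL with parameters $\eta,\gamma>0$ and base policy $\mu^0$: set $\tilde P^0\equiv0$, $\tilde L^0\equiv0$. For $t=1..T$: $\gamma^t_h(x_h,a_h)=\gamma/(1+\tilde P^{t-1}_{1:h}(x_h,a_h))$; $\tilde P^{t-1}_{1:h}(x_h)=\frac1{A(x_h)}\sum_{a_h}\tilde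 P^{t-1}_{1:h}(x_h,a_h)$; $\eta^t_h(x_h)=\min_{x'_{h'}\ge x_h}\eta/(1+\tilde P^{t-1}_{1:h'}(x'_{h'}))$; $\mu^t=\arg\min_{\mu\in\Pi_{\max}}\langle\mu_{1:},\tilde L^{t-1}\rangle+D_{\eta^t}(\mu,\mu^0)$; after the episode, $\tilde p^t_{1:h}(x_h,a_h)=\mathbb 1\{x^t_h=x_h,a^t_h=a_h\}/(\mu^t_{1:h}(x_h,a_h)+\gamma^t_h(x_h,a_h))$, $\tilde\ell^t_h(x_h,a_h)=\tilde p^t_{1:h}(x_h,a_h)(1-r^t_h)$, $\tilde P^t=\tilde P^{t-1}+\tilde p^t$, $\tilde L^t=\tilde L^{t-1}+\tilde\ell^t$. *)

(* Defs.v *)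
From HB Require Import structures.
From mathcomp Require Import all_boot all_order all_algebra.
From mathcomp Require Import all_classical all_reals all_analysis.
Set Implicit Arguments. Unset Strict Implicit. Unset Printing Implicit Defensive.
Import Order.TTheory GRing.Theory Num.Theory.
Local Open Scope classical_set_scope.
Local Open Scope ring_scope.

(** * Max-player information-set tree (perfect recall).
   [IX] = information sets, [IA] = pairs (x, a) with a in A(x);
   [own (x,a) = x]; [parent x = Some (x', a')] when (x', a') is the last
   step of the history of x, [None] when x is at step 1; [depth x = h]
   iff x is in X_h. *)
Record infotree := InfoTree {
  IX : finType;
  IA : finType;
  own : IA -> IX;
  parent : IX -> option IA;
  depth : IX -> nat }.

Arguments own {_}. Arguments parent {_}. Arguments depth {_}.

Definition tree_ok (H : nat) (G : infotree) : Prop :=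
  [/\ (forall x : IX G, (1 <= depth x <= H)%N),
      (forall x : IX G, parent x = None <-> depth x = 1%N),
      (forall (x : IX G) (a : IA G), parent x = Some a -> (depth (own a)).+1 = depth x)
    & (forall x : IX G, exists a : IA G, own a = x)].

Definition Aof (G : infotree) (x : IX G) : nat := #|[set a : IA G | own a == x]|.
Definition AX (G : infotree) : nat := #|IA G|.

Fixpoint anc (G : infotree) (n : nat) (x : IX G) : option (IX G) :=
  match n with
  | 0 => Some x
  | n'.+1 => match parent x with None => None | Some a => anc n' (own a) end
  end.

Definition ge_is (G : infotree) (x' x : IX G) : Prop := exists n, anc n x' = Some x.

Section Defs_R.
Variable R : realType.

Definition is_policy (G : infotree) (mu : IA G -> R) : Prop :=
  (forall a, 0 <= mu a) /\ (forall x : IX G, \sum_(a | own a == x) mu a = 1).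

Fixpoint seqf_fuel (G : infotree) (n : nat) (mu : IA G -> R) (a : IA G) : R :=
  match n with
  | 0 => 1
  | n'.+1 => mu a * (match parent (own a) with
                     | None => 1
                     | Some b => seqf_fuel n' mu b end)
  end.

Definition seqf (G : infotree) (mu : IA G -> R) (a : IA G) : R :=
  seqf_fuel (depth (own a)) mu a.

Definition ip (G : infotree) (m l : IA G -> R) : R := \sum_a m a * l a.

(** game quantities induced by a min-player policy *)
Definition valid_reach (H : nat) (G : infotree) (p : IX G -> R) : Prop :=
  [/\ (forall x, 0 <= p x),
      \sum_(x | depth x == 1%N) p x = 1
    & (forall a : IA G, (depth (own a) < H)%N ->
         \sum_(x | parent x == Some a) p x = p (own a))].

Definition valid_rew (G : infotree) (r : IA G -> R) : Prop :=
  forall a, 0 <= r a <= 1.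

Definition loss (G : infotree) (p : IX G -> R) (r : IA G -> R) (a : IA G) : R :=
  p (own a) * (1 - r a).

Definition mu_unif (G : infotree) (a : IA G) : R := ((Aof (own a))%:R)^-1.

(** Adaptive-FTRL quantities, for one realization of the observations:
   [traj s h] = (x^s_h, a^s_h), [rr s h] = r^s_h, [mu s] = mu^s. *)
Section Alg.
Variables (G : infotree) (gam : R) (traj : nat -> nat -> IA G)
          (rr : nat -> nat -> R) (mu : nat -> IA G -> R).

Definition ind (s : nat) (a : IA G) : R :=
  if traj s (depth (own a)) == a then 1 else 0.

Fixpoint Ptil (t : nat) (a : IA G) : R :=
  match t with
  | 0 => 0
  | s.+1 => Ptil s a + ind s.+1 a / (seqf (mu s.+1) a + gam / (1 + Ptil s a))
  end.

Fixpoint Ltil (t : nat) (a : IA G) : R :=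
  match t with
  | 0 => 0
  | s.+1 => Ltil s a + ind s.+1 a * (1 - rr s.+1 (depth (own a)))
                        / (seqf (mu s.+1) a + gam / (1 + Ptil s a))
  end.

Definition Pbar (t : nat) (x : IX G) : R :=
  ((Aof x)%:R)^-1 * \sum_(a | own a == x) Ptil t a.

(** eta^{t}_h(x_h), computed from \tilde P^{t-1} (argument tm1 = t-1) *)
Definition etaw (eta : R) (tm1 : nat) (x : IX G) : R :=
  \big[Num.min/(eta / (1 + Pbar tm1 x))]_(x' | `[< ge_is x' x >])
      (eta / (1 + Pbar tm1 x')).

End Alg.

Definition Ddil (G : infotree) (eta' : IX G -> R) (mu1 mu0 : IA G -> R) : R :=
  \sum_a seqf mu1 a / eta' (own a) * ln (mu1 a / mu0 a).

Definition ftrl_obj (G : infotree) (eta gam : R) (traj : nat -> nat -> IA G)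
  (rr : nat -> nat -> R) (mu : nat -> IA G -> R) (t : nat) (m : IA G -> R) : R :=
  ip (seqf m) (Ltil gam traj rr mu t.-1)
  + Ddil (etaw gam traj mu eta t.-1) m (@mu_unif G).

Definition ftrl_step (G : infotree) (eta gam : R) (traj : nat -> nat -> IA G)
  (rr : nat -> nat -> R) (mu : nat -> IA G -> R) (t : nat) : Prop :=
  is_policy (mu t) /\
  forall m, is_policy m -> ftrl_obj eta gam traj rr mu t (mu t) <= ftrl_obj eta gam traj rr mu t m.

Section Prob.
Variables (d : measure_display) (Om : measurableType d) (P : probability Om R).

Definition filtration (F : nat -> set (set Om)) : Prop :=
  forall t, [/\ sigma_algebra setT (F t), F t `<=` measurable & F t `<=` F t.+1].

Definition Fmeas (F : set (set Om)) (Y : Om -> R) : Prop :=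
  forall U : set R, measurable U -> F (Y @^-1` U).

(** Y is a version of E[X | F] (Y assumed F-measurable separately) *)
Definition cond_exp_is (F : set (set Om)) (X Y : Om -> R) : Prop :=
  forall B, F B ->
    (\int[P]_(w in B) (X w)%:E = \int[P]_(w in B) (Y w)%:E)%E.

End Prob.
End Defs_R.

(* Main.v *)
Require Import Defs.
From HB Require Import structures.
From mathcomp Require Import all_boot all_order all_algebra.
From mathcomp Require Import all_classical all_reals all_analysis.
From mathcomp Require Import measurable_realfun ring lra.
Import Order.TTheory GRing.Theory Num.Theory.
Local Open Scope classical_set_scope.
Local Open Scope ring_scope.

(**
The regret splits into a martingale term, the bias of the implicit
exploration, the deviation of the estimated cumulative losses and the regret of
FTRL on the estimated losses.

Concentration.  While [1 + Ptil <= B] the exploration bonus is at least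
[gam / B], so [expR (gam / B * (estimate - truth))] is a supermartingale; a
union bound over the [T] levels [B = 2 (1 + k)] and over the state-action pairs
yields [1 + Ptil <= B] and [Ltil - L <= iota' B / gam] for a level [B]
comparable to the true cumulative reach probability.

FTRL.  Backward induction on the tree writes the objective as a constant plus
[D(m, q)] with [q] a positive policy that has the same realisation weights as
[mu t].  By the data-processing inequality [eta (own a) * D(m, q)] dominates the
relative entropy of the realisation weights at any single [a].  Using this at
the [H] visited pairs, each with weight [1/H], bounds the stability term by
[H / 2 * \sum_a eta (own a) * ltil a], without any induction along the
trajectory.

The increments of [Ptil] relative to [1 + Ptil] sum to at most [lam], which
controls both the exploration bias and the stability term.  When
[T <= 36 iota' lam A_X] the bound is implied by the trivial [regret <= H T].
*)

Set Implicit Arguments. Unset Strict Implicit. Unset Printing Implicit Defensive.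

(** * Elementary inequalities *)

Section RealInequalities.
Context {R : realType}.
Implicit Types p q u x y : R.

Lemma ge_at0_of_derive (f df : R -> R) x :
  (forall y, is_derive y 1 f (df y)) -> (forall y, 0 <= y -> 0 <= df y) ->
  0 <= x -> f 0 <= f x.
Proof.
move=> fdf df0 x0.
apply: (@ger0_derive1_ndecry _ f 0) => //.
- move=> y; rewrite in_itv/= andbT => /ltW/df0.
  by rewrite derive1E (@derive_val _ _ _ _ _ _ _ (fdf y)).
- by apply: derivable_within_continuous => y _; case: (fdf y).
Qed.

Lemma expRN_le_quadratic x : 0 <= x -> expR (- x) <= 1 - x + x ^+ 2 / 2.
Proof.
move=> x0; rewrite -subr_ge0.
pose f y := 1 - y + y ^+ 2 / 2 - expR (- y).
have <- : f 0 = 0 by rewrite /f oppr0 expR0 expr0n /=; ring.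
apply: (@ge_at0_of_derive f (fun y => - 1 + y + expR (- y))) => // y.
  by rewrite /f; apply: is_derive_eq; rewrite ?scaler0 ?scale1r /GRing.scale/=; field.
by move=> _; have := expR_ge1Dx (- y); lra.
Qed.

(** The Padé bound on [expR], kept multiplied out so that no case [x < 2] is needed. It yields both
    the quadratic bound on the unit interval and [expR 1 <= 3]. *)
Lemma expR_mul_le x : 0 <= x -> expR x * (2 - x) <= 2 + x.
Proof.
move=> x0; rewrite -subr_ge0.
pose f y := 2 + y - expR y * (2 - y).
have <- : f 0 = 0 by rewrite /f expR0; ring.
apply: (@ge_at0_of_derive f (fun y => 1 - expR y * (1 - y))) => // y.
  by rewrite /f; apply: is_derive_eq; rewrite ?scaler0 ?scale1r /GRing.scale/=; ring.
(* Writing 1 as [expR y * expR (- y)] reduces the sign of the derivative to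
   [1 - y <= expR (- y)]. *)
move=> _; rewrite subr_ge0 -[leRHS](expRxMexpNx_1 y) ler_pM2l ?expR_gt0//.
by have := expR_ge1Dx (- y).
Qed.

Lemma expR_le_quadratic x : 0 <= x <= 1 -> expR x <= 1 + x + x ^+ 2.
Proof.
move=> /andP[x0 x1]; rewrite -(@ler_pM2r _ (2 - x)); last lra.
apply: le_trans (expR_mul_le x0) _; nra.
Qed.

Lemma expR1_le3 : expR 1 <= 3 :> R.
Proof. by have := @expR_mul_le 1 ler01; lra. Qed.

Lemma ln_ge_subinv x : 0 < x -> 1 - x^-1 <= ln x.
Proof.
move=> x0; have := @le_ln1Dx R (x^-1 - 1).
have xV : 0 < x^-1 by rewrite invr_gt0.
rewrite addrCA subrr addr0 lnV ?posrE//; lra.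
Qed.

(** Concavity of [ln] on the chord from 1 to 2. *)
Lemma mul_ln2_le y : 0 <= y <= 1 -> y * ln 2 <= ln (1 + y).
Proof.
move=> /andP[y0 y1].
have := @concave_ln R (Itv01 y0 y1) 2 1 (ltr0Sn _ 1) ltr01.
rewrite !convRE /= ln1 mulr0 addr0 mulr1 /unstable.onem.
by have -> : y * 2 + (1 - y) = 1 + y by ring.
Qed.

Lemma le_ln1D_div_ln2 y : 0 <= y <= 1 -> y <= ln (1 + y) / ln 2.
Proof. by move=> /mul_ln2_le; rewrite ler_pdivlMr// ln_gt0// ltr1n. Qed.

(* The generalised relative entropy term of [p] with respect to [q]; since
   [ln 0 = 0] it has the expected value [q] at [p = 0]. *)
Definition rel_ent p q := p * ln (p / q) - p + q.

(** For fixed [q] and [u] the right-hand side is minimal at [p = q * expR (- u)], with value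
    [q * (1 - u - expR (- u))]; the quadratic bound on [expR (- u)] finishes. *)
Lemma rel_ent_tilt p q u : 0 <= p -> 0 < q -> 0 <= u ->
  - (q * u ^+ 2 / 2) <= rel_ent p q + u * (p - q).
Proof.
move=> + q0 u0; have e2 := expRN_le_quadratic u0.
rewrite le_eqVlt => /predU1P[<-|p0]; rewrite /rel_ent.
  rewrite mul0r.
  have : q * expR (- u) <= q * (1 - u + u ^+ 2 / 2) by rewrite ler_pM2l.
  have : 0 < q * expR (- u) by rewrite mulr_gt0 ?expR_gt0.
  lra.
have xp : 0 < p / q * expR u by rewrite mulr_gt0 ?divr_gt0 ?expR_gt0.
have := ln_ge_subinv xp.
rewrite lnM ?posrE ?divr_gt0 ?expR_gt0// expRK invfM -expRN invf_div.
move=> /(ler_wpM2l (ltW p0)).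
have -> : p * (1 - q / p * expR (- u)) = p - q * expR (- u).
  by field; rewrite gt_eqF.
have : q * expR (- u) <= q * (1 - u + u ^+ 2 / 2) by rewrite ler_pM2l.
lra.
Qed.

Lemma rel_ent_ge0 p q : 0 <= p -> 0 < q -> 0 <= rel_ent p q.
Proof.
move=> p0 q0; have := rel_ent_tilt p0 q0 (lexx 0).
by rewrite mul0r addr0 expr0n/= mulr0 mul0r oppr0.
Qed.

(** If [p] is positive and differs from [q], then [1 + z < expR z] at [z = ln (q / p)] makes the
    term positive; at [p = 0] the term is [q]. *)
Lemma rel_ent_le0_eq p q : 0 <= p -> 0 < q -> rel_ent p q <= 0 -> p = q.
Proof.
move=> + q0; rewrite /rel_ent le_eqVlt => /predU1P[<-|p0]; first by lra.
have qp0 : 0 < q / p by rewrite divr_gt0.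
have [->//|pq H] := eqVneq p q.
have := @expR_gt1Dx _ (ln (q / p)).
have qp1 : q / p != 1.
  by apply: contra_neq pq => qp1; rewrite -[LHS]mul1r -qp1 divfK ?gt_eqF.
rewrite lnK ?posrE// ln_eq0// qp1 => /(_ isT).
rewrite -invf_div lnV ?posrE ?divr_gt0// in H *.
rewrite ltr_pdivlMr//; lra.
Qed.

End RealInequalities.

(** * Realisation weights *)

(* The paper's [mu_{1:h-1}] at the last step of the history of [x]. *)
Definition rho {R : realType} {G : infotree} (m : IA G -> R) (x : IX G) : R :=
  if parent x is Some b then seqf m b else 1.

Section Tree.
Context {R : realType} {H : nat} {G : infotree}.
Hypothesis okG : tree_ok H G.
Implicit Types (m q : IA G -> R) (x y : IX G) (a b : IA G) (p : IX G -> R).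

Lemma depth_gt0 x : (0 < depth x)%N.
Proof. by case: okG => /(_ x)/andP[]. Qed.

Lemma depth_leH x : (depth x <= H)%N.
Proof. by case: okG => /(_ x)/andP[]. Qed.

Lemma depth_parent x b : parent x = Some b -> depth x = (depth (own b)).+1.
Proof. by case: okG => _ _ dp _ /dp. Qed.

Lemma depth_root x : parent x = None <-> depth x = 1%N.
Proof. by case: okG => _ dr _ _; exact: dr. Qed.

Lemma tree_ind (Q : IX G -> Prop) :
  (forall x, (forall b, parent x = Some b -> Q (own b)) -> Q x) -> forall x, Q x.
Proof.
move=> IH x; have [n] := ubnP (depth x); elim: n x => // n IHn x xn.
by apply: IH => b /depth_parent xb; apply: IHn; rewrite xb in xn.
Qed.

(** Depth drops by exactly one at each parent, so the fuel [depth (own a)] is the length of the path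
    and the product obeys a one-step recursion. *)
Lemma seqfE m a : seqf m a = m a * rho m (own a).
Proof.
rewrite /seqf /rho; have := depth_gt0 (own a); case E: (depth (own a)) => [//|n] _ /=.
case Ep: (parent (own a)) => [b|//]; congr (_ * _).
by rewrite /seqf; move: (depth_parent Ep); rewrite E => -[<-].
Qed.

Lemma policy_le1 m a : is_policy m -> m a <= 1.
Proof.
move=> [m0 m1]; rewrite -(m1 (own a)) (bigD1 a)//= lerDl sumr_ge0//.
Qed.

Lemma rho_ge0 m x : is_policy m -> 0 <= rho m x.
Proof.
move=> mP; elim/tree_ind: x => x IH; rewrite /rho; case E: (parent x) => [b|//].
by rewrite seqfE mulr_ge0 ?IH//; case: mP.
Qed.

Lemma seqf_ge0 m a : is_policy m -> 0 <= seqf m a.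
Proof. by move=> mP; rewrite seqfE mulr_ge0 ?rho_ge0//; case: mP. Qed.

Lemma rho_le1 m x : is_policy m -> rho m x <= 1.
Proof.
move=> mP; elim/tree_ind: x => x IH; rewrite /rho; case E: (parent x) => [b|//].
by rewrite seqfE mulr_ile1 ?rho_ge0 ?IH ?policy_le1//; case: mP.
Qed.

Lemma seqf_le1 m a : is_policy m -> seqf m a <= 1.
Proof.
by move=> mP; rewrite seqfE mulr_ile1 ?rho_ge0 ?rho_le1 ?policy_le1//; case: mP.
Qed.

Lemma rho_gt0 m x : (forall a, 0 < m a) -> 0 < rho m x.
Proof.
move=> m0; elim/tree_ind: x => x IH; rewrite /rho; case E: (parent x) => [b|//].
by rewrite seqfE mulr_gt0 ?IH.
Qed.

Lemma seqf_gt0 m a : (forall a, 0 < m a) -> 0 < seqf m a.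
Proof. by move=> m0; rewrite seqfE mulr_gt0 ?rho_gt0. Qed.

Lemma sum_seqf_own m x : is_policy m -> \sum_(a | own a == x) seqf m a = rho m x.
Proof.
move=> [_ m1]; under eq_bigr => a /eqP ax do rewrite seqfE ax.
by rewrite -mulr_suml m1 mul1r.
Qed.

Lemma sum_own (f : IA G -> R) : \sum_a f a = \sum_x \sum_(a | own a == x) f a.
Proof. exact: (partition_big own predT). Qed.

Lemma sum_seqf_rho m p : is_policy m ->
  \sum_a seqf m a * p (own a) = \sum_x rho m x * p x.
Proof.
move=> mP; rewrite sum_own; apply: eq_bigr => x _.
under eq_bigr => a /eqP -> do [].
by rewrite -mulr_suml sum_seqf_own.
Qed.

(** Information sets are regrouped by the last step of their history. Together with [sum_seqf_rho]
    this makes value terms telescope down the tree. *)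
Lemma sum_rho m p : \sum_x rho m x * p x =
  \sum_(x | parent x == None) p x +
  \sum_a seqf m a * \sum_(x | parent x == Some a) p x.
Proof.
under [X in _ + X]eq_bigr do rewrite mulr_sumr.
rewrite (exchange_big_dep predT)//= [X in _ = X + _]big_mkcond/= -big_split/=.
apply: eq_bigr => x _; rewrite /rho; case E: (parent x) => [b|] /=.
  by rewrite add0r (big_pred1 b)// => a /=; rewrite eq_sym.
by rewrite big_pred0 ?addr0 ?mul1r.
Qed.

Lemma sum_depth (f : IX G -> R) :
  \sum_x f x = \sum_(h < H) \sum_(x | depth x == h.+1) f x.
Proof.
rewrite (exchange_big_dep predT)//=; apply: eq_bigr => x _.
have xH : ((depth x).-1 < H)%N by rewrite prednK ?depth_leH ?depth_gt0.
rewrite (big_pred1 (Ordinal xH))// => h /=.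
by rewrite -(inj_eq val_inj) /= -[RHS]eqSS prednK ?depth_gt0// eq_sym.
Qed.

Lemma reach_le_parent p x b : valid_reach H p -> parent x = Some b ->
  p x <= p (own b).
Proof.
move=> [p0 _ pS] xb; rewrite -pS; last by rewrite -(depth_parent xb) depth_leH.
by rewrite (bigD1 x) ?xb//= lerDl sumr_ge0.
Qed.

Lemma reach_le_ge_is p x y : valid_reach H p -> ge_is x y -> p x <= p y.
Proof.
move=> pP [n]; elim: n x => [|n IH] x /=; first by case=> ->.
by case E: (parent x) => [b|//] /IH; apply: le_trans; apply: reach_le_parent.
Qed.

Lemma reach_le1 p x : valid_reach H p -> p x <= 1.
Proof.
move=> pP; elim/tree_ind: x => x IH; case E: (parent x) => [b|].
  by rewrite (le_trans (reach_le_parent pP E)) ?IH.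
case: (pP) => p0 <- _; rewrite (bigD1 x) ?lerDl ?sumr_ge0//=.
by apply/eqP/depth_root.
Qed.

(** Each layer carries total probability one: by induction, the mass of a layer is split among its
    actions and then passed on to their children. *)
Lemma sum_rho_reach_depth m p h : is_policy m -> valid_reach H p -> (h < H)%N ->
  \sum_(x | depth x == h.+1) rho m x * p x = 1.
Proof.
move=> mP pP; elim: h => [|h IH] hH.
  case: pP => _ <- _; apply: eq_bigr => x /eqP/depth_root.
  by rewrite /rho => ->; rewrite mul1r.
rewrite -IH ?(ltnW hH)//.
transitivity (\sum_(a | depth (own a) == h.+1) seqf m a * p (own a)); last first.
  rewrite (partition_big own (fun x => depth x == h.+1))//=.
  apply: eq_bigr => x /eqP xh.
  rewrite -sum_seqf_own// mulr_suml; apply: eq_big => a.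
    by case: (own a =P x) => [->|]; rewrite ?xh ?eqxx ?andbF.
  by move=> /andP[_ /eqP ->].
rewrite [RHS](eq_bigr (fun a => \sum_(x | parent x == Some a) seqf m a * p x)).
  rewrite (exchange_big_dep (fun x => depth x == h.+2))/=.
    apply: eq_bigr => x /eqP xh; rewrite /rho.
    case E: (parent x) => [b|]; last first.
      by move/depth_root : E; rewrite xh.
    move: (depth_parent E); rewrite xh => -[bh].
    rewrite (big_pred1 b)// => a /=.
    rewrite (inj_eq Some_inj).
    by rewrite [RHS]eq_sym; case: (b =P a) => [<-|_]; rewrite ?andbF// -bh eqxx.
  by move=> a x /eqP ah /eqP /depth_parent ->; rewrite ah.
move=> a /eqP ah; rewrite -mulr_sumr; congr (_ * _).
by case: pP => _ _ ->//; rewrite ah.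
Qed.

Lemma sum_seqf_reach m p : is_policy m -> valid_reach H p ->
  \sum_a seqf m a * p (own a) = H%:R.
Proof.
move=> mP pP; rewrite sum_seqf_rho// sum_depth.
rewrite (eq_bigr (fun=> 1)) => [|h _]; last exact: sum_rho_reach_depth.
by rewrite sumr_const card_ord.
Qed.

End Tree.

(** * Dilated divergence *)

(** The Kullback-Leibler divergence of the action laws at [x], weighted by the realisation weight
    [rho m x]; dividing by the rate gives one node of the dilated divergence. *)
Definition node_kl {R : realType} {G : infotree} (m q : IA G -> R) (x : IX G) : R :=
  \sum_(b | own b == x) seqf m b * ln (m b / q b).

Section DilatedDivergence.
Context {R : realType} {H : nat} {G : infotree}.
Hypothesis okG : tree_ok H G.
Implicit Types (m q : IA G -> R) (x y : IX G) (a b : IA G) (eta : IX G -> R).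

Lemma DdilE eta m q : Ddil eta m q = \sum_x node_kl m q x / eta x.
Proof.
rewrite /Ddil sum_own; apply: eq_bigr => x _.
by rewrite mulr_suml; apply: eq_bigr => a /eqP ->; rewrite mulrAC.
Qed.

(** The chain rule for relative entropy. The linear terms match because the realisation weights of
    the actions at [x] sum to [rho]. *)
Lemma node_kl_rel_ent m q x : is_policy m -> is_policy q -> (forall a, 0 < q a) ->
  node_kl m q x + rel_ent (rho m x) (rho q x) =
  \sum_(b | own b == x) rel_ent (seqf m b) (seqf q b).
Proof.
move=> mP qP q0.
have rq0 := rho_gt0 okG x q0.
rewrite /rel_ent.
transitivity (\sum_(b | own b == x) (seqf m b * ln (m b / q b) +
  (seqf m b * ln (rho m x / rho q x) - seqf m b + seqf q b))).
  by rewrite big_split/= big_split/= sumrB -mulr_suml !(sum_seqf_own okG).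
apply: eq_bigr => b /eqP bx.
rewrite !addrA; congr (_ - _ + _); rewrite -mulrDr.
(* The logarithm splits only when both factors of the weight are positive; a zero weight kills the
   term instead. *)
have [->|sm0] := eqVneq (seqf m b) 0; first by rewrite !mul0r.
have : 0 < seqf m b by rewrite lt_neqAle eq_sym sm0 (seqf_ge0 okG).
rewrite !(seqfE okG) bx => s0; congr (_ * _).
have [mb0 rm0] : 0 < m b /\ 0 < rho m x.
  have := mP.1 b; rewrite le_eqVlt => /predU1P[mb|mb0].
    by move: s0; rewrite -mb mul0r ltxx.
  by rewrite mb0; move: s0; rewrite pmulr_rgt0.
rewrite -lnM ?posrE ?divr_gt0//; congr (ln _); field.
by rewrite !gt_eqF.
Qed.

Lemma node_kl_ge0 m q x : is_policy m -> is_policy q -> (forall a, 0 < q a) ->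
  0 <= node_kl m q x.
Proof.
move=> mP qP q0.
have : \sum_(b | own b == x) (m b - q b) <= \sum_(b | own b == x) m b * ln (m b / q b).
  apply: ler_sum => b _; have := rel_ent_ge0 (mP.1 b) (q0 b).
  by rewrite /rel_ent; lra.
rewrite sumrB (mP.2 x) (qP.2 x) subrr => h.
rewrite /node_kl; under eq_bigr => b /eqP bx do rewrite (seqfE okG) bx mulrAC.
by rewrite -mulr_suml mulr_ge0// (rho_ge0 okG).
Qed.

Lemma Ddil_ge0 eta m q : is_policy m -> is_policy q -> (forall a, 0 < q a) ->
  (forall x, 0 < eta x) -> 0 <= Ddil eta m q.
Proof.
move=> mP qP q0 e0; rewrite DdilE sumr_ge0// => x _.
by rewrite divr_ge0 ?node_kl_ge0// ltW.
Qed.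

Lemma Ddil_anti eta eta' m q : is_policy m -> is_policy q -> (forall a, 0 < q a) ->
  (forall x, 0 < eta' x <= eta x) -> Ddil eta m q <= Ddil eta' m q.
Proof.
move=> mP qP q0 e0; rewrite !DdilE; apply: ler_sum => x _.
have /andP[e1 e2] := e0 x.
by rewrite ler_wpM2l ?node_kl_ge0// lef_pV2 ?posrE// (lt_le_trans e1).
Qed.

Lemma ge_is_refl x : ge_is x x.
Proof. by exists 0%N. Qed.

Lemma ge_is_trans y x z : ge_is x y -> ge_is y z -> ge_is x z.
Proof.
move=> [n xy] [k yz]; exists (n + k)%N.
elim: n x xy => [|n IH] x /=; first by case=> ->.
by case: (parent x) => // b /IH.
Qed.

Lemma ge_isE x y : ge_is x y <->
  y = x \/ exists2 b, parent x = Some b & ge_is (own b) y.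
Proof.
split=> [[[[]|n /=]]|[->|[b xb [n by_]]]]; first by left.
- by case E: (parent x) => [b|//] ?; right; exists b => //; exists n.
- exact: ge_is_refl.
- by exists n.+1; rewrite /= xb.
Qed.

Lemma ge_is_depth x y : ge_is x y -> (depth y <= depth x)%N.
Proof.
move=> [n]; elim: n x => [|n IH] x /=; first by case=> ->.
case E: (parent x) => [b|//] /IH; rewrite (depth_parent okG E) => h.
exact: leq_trans h _.
Qed.

(* Data-processing inequality: the relative entropy of the law of the
   actions taken at [x] is at most that of the whole path down to [x]. *)
Lemma sum_rel_ent_le_path m q x : is_policy m -> is_policy q -> (forall a, 0 < q a) ->
  \sum_(b | own b == x) rel_ent (seqf m b) (seqf q b) <=
  \sum_(y | `[< ge_is x y >]) node_kl m q y.
Proof.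
move=> mP qP q0; elim/(tree_ind okG): x => x IH.
rewrite -node_kl_rel_ent// (bigD1 x)/=; last exact/asboolP/ge_is_refl.
rewrite lerD2l.
case E: (parent x) => [b|]; last first.
  rewrite /rho E /rel_ent divr1 ln1 mulr0 sub0r addNr.
  by rewrite sumr_ge0// => y _; apply: node_kl_ge0.
rewrite (eq_bigl (fun y => `[< ge_is (own b) y >])); last first.
  move=> y; apply/andP/idP => [[/asboolP/ge_isE[->|[b']]]|/asboolP yb].
  - by rewrite eqxx.
  - by rewrite E => -[<-] yb _; apply/asboolP.
  - split; first by apply/asboolP/ge_isE; right; exists b.
    apply: contraTneq (ge_is_depth yb) => ->.
    by rewrite (depth_parent okG E) ltnn.
(* The term of the parent action [b] alone is at most the whole sum at the previous information
   set. *)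
apply: le_trans (IH _ E); rewrite /rho E (bigD1 b)//= lerDl sumr_ge0// => c _.
by rewrite rel_ent_ge0 ?(seqf_ge0 okG)// (seqf_gt0 okG).
Qed.

(** Rates do not decrease down the tree, so [eta (own a) / eta y] is at least 1 at every [y] on the
    path; nodes off the path contribute nonnegative terms. *)
Lemma rel_ent_le_Ddil eta m q a : is_policy m -> is_policy q -> (forall a, 0 < q a) ->
  (forall x, 0 < eta x) -> (forall x y, ge_is x y -> eta y <= eta x) ->
  rel_ent (seqf m a) (seqf q a) <= eta (own a) * Ddil eta m q.
Proof.
move=> mP qP q0 e0 emon.
have re0 b : 0 <= rel_ent (seqf m b) (seqf q b).
  by rewrite rel_ent_ge0 ?(seqf_ge0 okG)// (seqf_gt0 okG).
apply: (@le_trans _ _ (\sum_(b | own b == own a) rel_ent (seqf m b) (seqf q b))).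
  by rewrite (bigD1 a)//= lerDl sumr_ge0.
apply: le_trans (sum_rel_ent_le_path _ mP qP q0) _.
rewrite DdilE mulr_sumr [leRHS](bigID (fun y => `[< ge_is (own a) y >]))/=.
rewrite -[leLHS]addr0 lerD//; last first.
  apply: sumr_ge0 => y _.
  by rewrite mulr_ge0 ?divr_ge0 ?node_kl_ge0// ltW.
apply: ler_sum => y /asboolP/emon ey.
rewrite mulrCA -[leLHS]mulr1 ler_wpM2l ?node_kl_ge0//.
by rewrite ler_pdivlMr// mul1r.
Qed.

(** * Uniform base policy and backward induction for the FTRL minimiser *)

Lemma Aof_gt0 x : (0 < Aof x)%N.
Proof.
case: okG => _ _ _ /(_ x)[a ax]; apply/card_gt0P; exists a.
by rewrite inE /= ax.
Qed.

Lemma mu_unif_gt0 a : 0 < @mu_unif R G a.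
Proof. by rewrite invr_gt0 ltr0n Aof_gt0. Qed.

Lemma sum_own_const x (c : R) : \sum_(a : IA G | own a == x) c = (Aof x)%:R * c.
Proof.
rewrite sumr_const mulr_natl; congr (_ *+ _).
by apply: eq_card => a; rewrite unfold_in; symmetry; apply: asboolb.
Qed.

Lemma mu_unif_policy : is_policy (@mu_unif R G).
Proof.
split=> [a|x]; first exact/ltW/mu_unif_gt0.
rewrite (eq_bigr (fun=> (Aof x)%:R^-1)) => [|a /eqP ax]; last by rewrite /mu_unif ax.
by rewrite sum_own_const divff// pnatr_eq0 -lt0n Aof_gt0.
Qed.

(** A soft-min backward recursion. Iterated from zero, the map is stationary at [x] once the number
    of iterations exceeds [H - depth x], so [H] iterations suffice everywhere. *)
Lemma exists_soft_value eta (L : IA G -> R) : exists V : IX G -> R, forall x,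
  V x = - ln (\sum_(a | own a == x) @mu_unif R G a *
    expR (- (eta x * (L a + \sum_(y | parent y == Some a) V y)))) / eta x.
Proof.
pose step (V : IX G -> R) x := - ln (\sum_(a | own a == x) @mu_unif R G a *
    expR (- (eta x * (L a + \sum_(y | parent y == Some a) V y)))) / eta x.
suff stable n x : (H < depth x + n)%N ->
    iter n.+1 step (fun=> 0) x = iter n step (fun=> 0) x.
  exists (iter H step (fun=> 0)) => x; rewrite -stable//.
  by rewrite -addn1 addnC leq_add2r (depth_gt0 okG).
elim: n x => [|n IH] x xn; first by have := depth_leH okG x; rewrite leqNgt -[depth x]addn0 xn.
change (step (iter n.+1 step (fun=> 0)) x = step (iter n step (fun=> 0)) x).
apply: (congr1 (fun z => - ln z / eta x)).
apply: eq_bigr => a /eqP ax; congr (_ * expR (- (_ * (_ + _)))).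
apply: eq_bigr => y /eqP ya; apply: IH.
by rewrite (depth_parent okG ya) ax addSnnS.
Qed.

(* The FTRL objective is, up to a constant, the divergence to the policy
   obtained by backward induction on the tree. *)
Lemma ftrl_closed_form eta (L : IA G -> R) : (forall x, 0 < eta x) ->
  exists q C, [/\ is_policy q, forall a, 0 < q a & forall m, is_policy m ->
    ip (seqf m) L + Ddil eta m (@mu_unif R G) = C + Ddil eta m q].
Proof.
move=> e0; have [V VE] := exists_soft_value eta L.
pose cost a := L a + \sum_(y | parent y == Some a) V y.
(* The Gibbs policy of the soft values; the recursion for [V] is exactly its normalisation. *)
pose q a := @mu_unif R G a * expR (eta (own a) * (V (own a) - cost a)).
have q0 a : 0 < q a by rewrite mulr_gt0 ?mu_unif_gt0 ?expR_gt0.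
have Z0 x : 0 < \sum_(a | own a == x) @mu_unif R G a * expR (- (eta x * cost a)).
  have [a ax] : exists a : IA G, own a = x by case: okG.
  rewrite (bigD1 a) ?ax//= ltr_pwDl ?mulr_gt0 ?mu_unif_gt0 ?expR_gt0//.
  by rewrite sumr_ge0// => b _; rewrite ltW// mulr_gt0 ?mu_unif_gt0 ?expR_gt0.
exists q, (\sum_(x | parent x == None) V x); split => //.
  split=> [a|x]; first exact: ltW.
  transitivity (expR (eta x * V x) *
      \sum_(a | own a == x) @mu_unif R G a * expR (- (eta x * cost a))).
    rewrite mulr_sumr; apply: eq_bigr => a /eqP ax.
    by rewrite /q ax mulrBr expRD mulrCA.
  have -> : eta x * V x =
      - ln (\sum_(a | own a == x) @mu_unif R G a * expR (- (eta x * cost a))).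
    by rewrite {1}VE mulrCA divff ?mulr1// gt_eqF.
  by rewrite expRN lnK ?posrE ?Z0// mulVf// gt_eqF.
move=> m mP.
(* Per pair, the two divergences differ by value terms which telescope over the tree and leave only
   the roots, the constant above. *)
have step a : seqf m a * L a + seqf m a / eta (own a) * ln (m a / @mu_unif R G a) =
    seqf m a / eta (own a) * ln (m a / q a) + seqf m a * V (own a)
    - seqf m a * \sum_(y | parent y == Some a) V y.
  have := mP.1 a; rewrite le_eqVlt => /predU1P[ma|ma0].
    by rewrite (seqfE okG) -ma !mul0r; ring.
  rewrite /q ln_div ?posrE ?mulr_gt0 ?mu_unif_gt0 ?expR_gt0//.
  rewrite ln_div ?posrE ?mulr_gt0 ?mu_unif_gt0 ?expR_gt0//.
  rewrite lnM ?posrE ?mu_unif_gt0 ?expR_gt0// expRK /cost.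
  by field; rewrite gt_eqF.
rewrite /ip /Ddil -big_split/= (eq_bigr _ (fun a _ => step a)) sumrB big_split/=.
by rewrite (sum_seqf_rho okG)// (sum_rho m V); ring.
Qed.

End DilatedDivergence.

(** * FTRL along one realisation *)

(** [on] marks the visited pairs. Each receives a share [1 / H] of the divergence, which pays for
    the relative entropy at that pair. *)
Lemma Ddil_stability {R : realType} {H : nat} {G : infotree} (on : pred (IA G))
    (eta : IX G -> R) (l m q : IA G -> R) :
  tree_ok H G -> (0 < H)%N -> \sum_(a | on a) (1 : R) <= H%:R ->
  is_policy m -> is_policy q -> (forall a, 0 < q a) ->
  (forall x, 0 < eta x) -> (forall x y, ge_is x y -> eta y <= eta x) ->
  (forall a, ~~ on a -> l a = 0) -> (forall a, 0 <= l a) ->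
  (forall a, seqf q a * l a <= 1) ->
  ip (seqf q) l - H%:R / 2 * (\sum_a eta (own a) * l a) <=
  ip (seqf m) l + Ddil eta m q.
Proof.
move=> okG H0 onH mP qP q0 e0 emon lon l0 ql.
have HR : 0 < H%:R :> R by rewrite ltr0n.
have lsum (f : IA G -> R) : \sum_a f a * l a = \sum_(a | on a) f a * l a.
  rewrite [LHS](bigID on)/= [X in _ + X]big1 ?addr0// => a /lon ->.
  by rewrite mulr0.
have D0 : 0 <= Ddil eta m q by apply: Ddil_ge0 okG _ _ _ _ _ _ _.
have DD : \sum_(a | on a) Ddil eta m q / H%:R <= Ddil eta m q.
  under eq_bigr do rewrite -[Ddil _ _ _]mul1r -mulrA.
  rewrite -mulr_suml mulrCA -[leRHS]mulr1 ler_wpM2l// ler_pdivrMr// mul1r//.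
rewrite lerBlDr -addrA -lerBlDl.
rewrite /ip !lsum mulr_sumr -sumrB.
apply: le_trans (lerD DD (lexx _)).
rewrite -big_split/=; apply: ler_sum => a _.
have := rel_ent_le_Ddil okG a mP qP q0 e0 emon.
set D := Ddil _ _ _ => reD.
have ea := e0 (own a); have la := l0 a; have qa := ql a.
(* The slope of the tilt: after division by [H * eta (own a)] it matches the loss [l a] against a
   share [1 / H] of the divergence. *)
have Hel : 0 <= H%:R * eta (own a) * l a by rewrite mulr_ge0 ?mulr_ge0 ?(ltW ea).
have := rel_ent_tilt (seqf_ge0 okG a mP) (seqf_gt0 okG a q0) Hel.
set p := seqf m a in reD *; set k := seqf q a in reD qa *.
set re := rel_ent p k in reD *; set e := eta _ in reD ea Hel *.
move=> h.
have He : 0 < H%:R * e by rewrite mulr_gt0.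
rewrite -(ler_pM2l He).
have -> : H%:R * e * (D / H%:R + H%:R / 2 * (e * l a)) =
  e * D + (H%:R * e) ^+ 2 * l a / 2 by field; rewrite gt_eqF.
(* The bound [seqf q a * l a <= 1] makes the quadratic remainder linear in [l a]. *)
have : (H%:R * e) ^+ 2 * l a * (k * l a) <= (H%:R * e) ^+ 2 * l a * 1.
  by rewrite ler_wpM2l// mulr_ge0 ?sqr_ge0.
nra.
Qed.

(** * Estimates, adaptive rates and the value of FTRL along a run *)

Section Algorithm.
Context {R : realType} {H : nat} {G : infotree}.
Hypothesis okG : tree_ok H G.
Variables (T : nat) (eta gam : R) (traj : nat -> nat -> IA G)
  (rr : nat -> nat -> R) (mu : nat -> IA G -> R).
Hypothesis H0 : (0 < H)%N.
Hypothesis eta0 : 0 < eta.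
Hypothesis gam0 : 0 < gam.
Hypothesis trajP : forall t h, (1 <= t <= T)%N -> (1 <= h <= H)%N ->
  depth (own (traj t h)) = h.
Hypothesis rrP : forall t h, (1 <= t <= T)%N -> (1 <= h <= H)%N ->
  0 <= rr t h <= 1.
Hypothesis muP : forall t, (1 <= t <= T)%N -> is_policy (mu t).

Local Notation Pt := (Ptil gam traj mu).
Local Notation Lt := (Ltil gam traj rr mu).
Local Notation Pb := (Pbar gam traj mu).
Local Notation eW := (etaw gam traj mu eta).

Definition pinc t a : R := ind R traj t a / (seqf (mu t) a + gam / (1 + Pt t.-1 a)).
Definition linc t (a : IA G) : R := pinc t a * (1 - rr t (depth (own a))).

Lemma PtilS t a : Pt t.+1 a = Pt t a + pinc t.+1 a.
Proof. by []. Qed.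

Lemma LtilS t a : Lt t.+1 a = Lt t a + linc t.+1 a.
Proof. by rewrite /= /linc /pinc mulrAC. Qed.

Lemma ind_ge0 t a : 0 <= ind R traj t a.
Proof. by rewrite /ind; case: ifP. Qed.

Lemma Ptil_ge0 t a : (t <= T)%N -> 0 <= Pt t a.
Proof.
elim: t => [//|t IH] tT; have P0 := IH (ltnW tT).
rewrite PtilS addr_ge0// /pinc divr_ge0 ?ind_ge0// addr_ge0 ?(seqf_ge0 okG _ (muP _))//.
by rewrite divr_ge0 ?addr_ge0// ltW.
Qed.

Lemma one_add_Ptil_gt0 t a : (t <= T)%N -> 0 < 1 + Pt t a.
Proof. by move=> tT; rewrite ltr_pwDl ?Ptil_ge0. Qed.

Lemma weight_gt0 t a : (1 <= t <= T)%N ->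
  0 < seqf (mu t) a + gam / (1 + Pt t.-1 a).
Proof.
move=> tT; rewrite ltr_wpDl ?(seqf_ge0 okG _ (muP _))// divr_gt0// one_add_Ptil_gt0//.
by case/andP: tT => _; apply: leq_trans; exact: leq_pred.
Qed.

Lemma pinc_ge0 t a : (1 <= t <= T)%N -> 0 <= pinc t a.
Proof. by move=> tT; rewrite /pinc divr_ge0 ?ind_ge0// ltW ?weight_gt0. Qed.

Lemma Ptil_mono s t a : (s <= t)%N -> (t <= T)%N -> Pt s a <= Pt t a.
Proof.
move=> st tT; elim: t st tT => [|t IH]; first by rewrite leqn0 => /eqP ->.
rewrite leq_eqVlt => /predU1P[->//|st] tT.
by rewrite (le_trans (IH st (ltnW tT)))// PtilS lerDl pinc_ge0.
Qed.

Lemma rr_bound t (a : IA G) : (1 <= t <= T)%N -> 0 <= 1 - rr t (depth (own a)) <= 1.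
Proof.
move=> tT; have : (1 <= depth (own a) <= H)%N by rewrite (depth_gt0 okG) (depth_leH okG).
by move=> /(rrP tT)/andP[]; lra.
Qed.

Lemma linc_ge0 t a : (1 <= t <= T)%N -> 0 <= linc t a.
Proof. by move=> tT; rewrite /linc mulr_ge0 ?pinc_ge0//; case/andP: (rr_bound a tT). Qed.

Lemma linc_le t a : (1 <= t <= T)%N -> linc t a <= pinc t a.
Proof. by move=> tT; rewrite /linc ler_piMr ?pinc_ge0//; case/andP: (rr_bound a tT). Qed.

Lemma weight_pinc t a : (1 <= t <= T)%N ->
  (seqf (mu t) a + gam / (1 + Pt t.-1 a)) * pinc t a = ind R traj t a.
Proof. by move=> tT; rewrite /pinc mulrCA divff ?mulr1// gt_eqF ?weight_gt0. Qed.

Lemma ind_le1 t a : ind R traj t a <= 1.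
Proof. by rewrite /ind; case: ifP. Qed.

Lemma seqf_pinc t a : (1 <= t <= T)%N -> seqf (mu t) a * pinc t a <= 1.
Proof.
move=> tT; apply: le_trans (ind_le1 t a); rewrite -weight_pinc//.
rewrite ler_wpM2r ?pinc_ge0// lerDl divr_ge0 ?(ltW gam0)// ltW// one_add_Ptil_gt0//.
by case/andP: tT => _; apply: leq_trans; exact: leq_pred.
Qed.

(** The exploration bonus alone bounds the denominator from below. For [gam >= 1] this keeps the
    increment relative to [1 + Ptil] at most 1. *)
Lemma pinc_le t a : (1 <= t <= T)%N -> gam * pinc t a <= 1 + Pt t.-1 a.
Proof.
move=> tT; have P0 : 0 < 1 + Pt t.-1 a.
  by rewrite one_add_Ptil_gt0//; case/andP: tT => _; apply: leq_trans; exact: leq_pred.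
rewrite -[leRHS]mulr1 -ler_pdivrMl// mulrA; apply: le_trans (ind_le1 t a); rewrite -weight_pinc//.
by rewrite ler_wpM2r ?pinc_ge0// mulrC lerDr (seqf_ge0 okG _ (muP _)).
Qed.

Lemma pinc0 t a : traj t (depth (own a)) != a -> pinc t a = 0.
Proof. by rewrite /pinc /ind => /negbTE ->; rewrite mul0r. Qed.

(** A run visits one pair per layer, so depth is injective on the visited pairs. *)
Lemma sum_on_traj t : (1 <= t <= T)%N ->
  \sum_(a | traj t (depth (own a)) == a) (1 : R) <= H%:R.
Proof.
move=> tT; rewrite sumr_const ler_nat -[leqRHS](card_ord H).
have depthI (a : IA G) : ((depth (own a)).-1 < H)%N.
  by rewrite prednK ?(depth_gt0 okG) ?(depth_leH okG).
apply: (@leq_card_in _ _ (fun a => Ordinal (depthI a))).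
move=> a b; rewrite !unfold_in => /eqP <- /eqP <- /(congr1 val)/= E.
congr (traj t _); move: E; rewrite !trajP ?(depth_gt0 okG) ?(depth_leH okG)//.
by move/(congr1 S); rewrite !prednK ?(depth_gt0 okG).
Qed.

Lemma sum_ind t : (1 <= t <= T)%N -> \sum_a ind R traj t a <= H%:R.
Proof. by move=> tT; rewrite /ind -big_mkcond; exact: sum_on_traj. Qed.

Lemma Pbar_le t x (M : R) : (forall a, own a = x -> Pt t a <= M) -> Pb t x <= M.
Proof.
move=> PM; rewrite /Pbar ler_pdivrMl ?ltr0n ?(Aof_gt0 okG)//.
by rewrite -sum_own_const; apply: ler_sum => a /eqP/PM.
Qed.

Lemma Pbar_ge0 t x : (t <= T)%N -> 0 <= Pb t x.
Proof.
by move=> tT; rewrite /Pbar mulr_ge0 ?invr_ge0// sumr_ge0// => a _; rewrite Ptil_ge0.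
Qed.

Lemma one_add_Pbar_gt0 t x : (t <= T)%N -> 0 < 1 + Pb t x.
Proof. by move=> tT; rewrite ltr_pwDl ?Pbar_ge0. Qed.

Lemma Pbar_mono t x : (t < T)%N -> Pb t x <= Pb t.+1 x.
Proof.
move=> tT; rewrite /Pbar ler_wpM2l ?invr_ge0//; apply: ler_sum => a _.
exact: Ptil_mono.
Qed.

Lemma etaw_le t x y : ge_is y x -> eW t x <= eta / (1 + Pb t y).
Proof. by move=> yx; apply: bigmin_le_cond; apply/asboolP. Qed.

Lemma le_etaw t x (M : R) :
  (forall y, ge_is y x -> M <= eta / (1 + Pb t y)) -> M <= eW t x.
Proof.
move=> h; apply: le_bigmin => [|y /asboolP/h//]; exact/h/ge_is_refl.
Qed.

Lemma etaw_gt0 t x : (t <= T)%N -> 0 < eW t x.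
Proof.
move=> tT; apply: lt_bigmin => [|y _]; by rewrite divr_gt0// one_add_Pbar_gt0.
Qed.

Lemma etaw_ge_is t x y : ge_is x y -> eW t y <= eW t x.
Proof.
by move=> xy; apply: le_etaw => z zx; apply/etaw_le/(ge_is_trans zx).
Qed.

Lemma etaw_anti t x : (t < T)%N -> eW t.+1 x <= eW t x.
Proof.
move=> tT; apply: le_etaw => y yx; apply: le_trans (etaw_le _ yx) _.
rewrite ler_pM2l// lef_pV2 ?posrE ?one_add_Pbar_gt0// 1?ltnW//.
by rewrite lerD2l Pbar_mono.
Qed.

Definition stab t : R := H%:R / 2 * (\sum_a eW t.-1 (own a) * linc t a).

Hypothesis ftrlP : forall t, (1 <= t <= T)%N -> ftrl_step eta gam traj rr mu t.

(* The divergence terms grow with [t] since the weights [eW t] decrease, so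
   the optimal value loses only the stability term at each step. *)
Lemma ftrl_value_ge t m : (t <= T)%N -> is_policy m ->
  \sum_(1 <= s < t.+1) (ip (seqf (mu s)) (linc s) - stab s) <=
  ip (seqf m) (Lt t) + Ddil (eW t) m (@mu_unif R G).
Proof.
have u0 := @mu_unif_gt0 R H G okG; have uP := @mu_unif_policy R H G okG.
elim: t m => [|t IH] m tT mP.
  rewrite big_geq// addr_ge0//; last first.
    by apply: (Ddil_ge0 okG) => // x; exact: etaw_gt0.
  by rewrite /ip sumr_ge0// => a _; rewrite mulr0.
have tT1 : (1 <= t.+1 <= T)%N by [].
rewrite big_nat_recr//=.
have e0 x : 0 < eW t x by rewrite etaw_gt0// ltnW.
have [q [C [qP q0 qC]]] := ftrl_closed_form okG (Lt t) e0.
have [mP' mumin] := ftrlP tT1.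
have Dq : Ddil (eW t) q q = 0.
  by rewrite /Ddil big1// => a _; rewrite divff ?ln1 ?mulr0// gt_eqF.
have Dmu : Ddil (eW t) (mu t.+1) q <= 0.
  by have := mumin q qP; rewrite /ftrl_obj/= !qC// Dq lerD2l.
(* [mu t.+1] may differ from [q] at unreached information sets; a nonpositive divergence only forces
   equal realisation weights. *)
have smu a : seqf (mu t.+1) a = seqf q a.
  apply: rel_ent_le0_eq; rewrite ?(seqf_ge0 okG) ?(seqf_gt0 okG)//.
  apply: le_trans (rel_ent_le_Ddil okG a mP' qP q0 e0 (@etaw_ge_is t)) _.
  by rewrite pmulr_rle0.
(* The induction hypothesis at the minimiser itself bounds the constant [C] from below. *)
have := IH _ (ltnW tT) mP'.
have Dmu0 : Ddil (eW t) (mu t.+1) q = 0.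
  by apply/eqP; rewrite eq_le Dmu/=; apply: (Ddil_ge0 okG).
rewrite qC// Dmu0 addr0 => IHC.
have -> : ip (seqf m) (Lt t.+1) = ip (seqf m) (Lt t) + ip (seqf m) (linc t.+1).
  rewrite /ip -big_split/=; apply: eq_bigr => a _.
  by rewrite -mulrDr -LtilS.
have := Ddil_anti okG (eta := eW t) (eta' := eW t.+1) mP uP u0.
move=> /(_ (fun x => _)) DA.
apply: (@le_trans _ _ (ip (seqf m) (Lt t) + ip (seqf m) (linc t.+1) +
    Ddil (eW t) m (@mu_unif R G))); last first.
  by rewrite lerD2l; apply: DA => x; rewrite etaw_gt0 ?etaw_anti.
rewrite addrAC qC// -addrA; apply: lerD => //.
have -> : ip (seqf (mu t.+1)) (linc t.+1) = ip (seqf q) (linc t.+1).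
  by apply: eq_bigr => a _; rewrite smu.
rewrite [leRHS]addrC.
apply: (Ddil_stability (on := fun a => traj t.+1 (depth (own a)) == a) okG) => //.
- exact: sum_on_traj.
- exact: etaw_ge_is.
- by move=> a /pinc0 h; rewrite /linc h mul0r.
- by move=> a; exact: linc_ge0.
- move=> a; apply: le_trans (seqf_pinc a tT1); rewrite smu.
  by rewrite ler_wpM2l ?linc_le// ltW// (seqf_gt0 okG).
Qed.

End Algorithm.

(** * Regret on the good event *)

(** A relative increment [y] in the unit interval is at most the base-2 logarithm of [1 + y], and
    [1 + y] is the ratio of consecutive values of [1 + u], so the logarithms telescope. *)
Lemma sum_increment_le_ln {R : realType} (u : nat -> R) (t : nat) :
  u 0%N = 0 -> (forall s, (s < t)%N -> 0 <= u s) ->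
  (forall s, (s < t)%N -> u s <= u s.+1 <= u s + (1 + u s)) ->
  \sum_(1 <= s < t.+1) (u s - u s.-1) / (1 + u s.-1) <= ln (1 + u t) / ln 2.
Proof.
move=> u0; elim: t => [|t IH] upos ustep.
  by rewrite big_geq// u0 addr0 ln1 mul0r.
rewrite big_nat_recr//=.
have ut := upos t (leqnn _); have /andP[ut1 ut2] := ustep t (leqnn _).
have ut0 : 0 < 1 + u t by lra.
have yP : 0 <= (u t.+1 - u t) / (1 + u t) <= 1.
  by rewrite divr_ge0 ?subr_ge0 ?(ltW ut0)//= ler_pdivrMr// mul1r; lra.
have := IH (fun s st => upos s (ltnW st)) (fun s st => ustep s (ltnW st)).
move=> /lerD/(_ (le_ln1D_div_ln2 yP)) /le_trans; apply.
rewrite -mulrDl ler_wpM2r ?invr_ge0 ?ln_ge0 ?ler1n//.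
have -> : 1 + (u t.+1 - u t) / (1 + u t) = (1 + u t.+1) / (1 + u t).
  by field; rewrite gt_eqF.
by rewrite ln_div ?posrE//; lra.
Qed.

Section Regret.
Context {R : realType} {H : nat} {G : infotree}.
Hypothesis okG : tree_ok H G.
Variables (T : nat) (eta gam io lam : R) (traj : nat -> nat -> IA G)
  (rr : nat -> nat -> R) (mu : nat -> IA G -> R)
  (p : nat -> IX G -> R) (r : nat -> IA G -> R).
Hypothesis H0 : (0 < H)%N.
Hypothesis eta0 : 0 < eta.
Hypothesis gam1 : 1 <= gam.
Hypothesis io0 : 0 <= io.
Hypothesis io_gam : 2 * io <= gam.
Hypothesis Aof_io : forall x : IX G, ln (Aof x)%:R <= io.
Hypothesis lamE : lam = 1 + ln (1 + T%:R) / ln 2.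
Hypothesis trajP : forall t h, (1 <= t <= T)%N -> (1 <= h <= H)%N ->
  depth (own (traj t h)) = h.
Hypothesis rrP : forall t h, (1 <= t <= T)%N -> (1 <= h <= H)%N ->
  0 <= rr t h <= 1.
Hypothesis ftrlP : forall t, (1 <= t <= T)%N -> ftrl_step eta gam traj rr mu t.
Hypothesis pP : forall t, valid_reach H (p t).

Local Notation Pt := (Ptil gam traj mu).
Local Notation Lt := (Ltil gam traj rr mu).
Local Notation Pb := (Pbar gam traj mu).
Local Notation eW := (etaw gam traj mu eta).
Local Notation pinc := (pinc gam traj mu).
Local Notation linc := (linc gam traj rr mu).
Local Notation ell t := (loss (p t) (r t)).
Local Notation stab := (@stab _ H _ eta gam traj rr mu).

(** This and the next two hypotheses describe the good event for one realisation. Truncating at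
    level [2 * (1 + k)] keeps the bonus at least [gam] over that level. *)
Hypothesis pinc_conc : forall a k, (1 <= k <= T)%N ->
  \sum_(1 <= t < T.+1) (if 1 + Pt t.-1 a <= 2 * (1 + k%:R)
                        then pinc t a - p t (own a) else 0)
  <= io * (2 * (1 + k%:R)) / gam.
Hypothesis linc_conc : forall a k, (1 <= k <= T)%N ->
  \sum_(1 <= t < T.+1) (if 1 + Pt t.-1 a <= 2 * (1 + k%:R)
                        then linc t a - ell t a else 0)
  <= io * (2 * (1 + k%:R)) / gam.
Hypothesis loss_conc : \sum_(1 <= t < T.+1)
  (ip (seqf (mu t)) (ell t) - \sum_a ind R traj t a * (1 - rr t (depth (own a))))
  <= H%:R * Num.sqrt (2 * io * T%:R).

Let gam0 : 0 < gam. Proof. exact: lt_le_trans ltr01 gam1. Qed.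
Let muP t : (1 <= t <= T)%N -> is_policy (mu t).
Proof. by move=> /ftrlP[]. Qed.

Let pinc_ge0' := pinc_ge0 okG traj gam0 muP.
Let Ptil_ge0' := Ptil_ge0 okG traj gam0 muP.

Let pcum x : R := \sum_(1 <= t < T.+1) p t x.

Lemma pcum_ge0 x : 0 <= pcum x.
Proof. by apply: sumr_ge0 => t _; case: (pP t). Qed.

Lemma pcum_le x : pcum x <= T%:R.
Proof.
apply: (@le_trans _ _ (\sum_(1 <= t < T.+1) 1)).
  by apply: ler_sum => t _; apply: (reach_le1 okG).
by rewrite sumr_const_nat subn1.
Qed.

Lemma pcum_ge_is x y : ge_is y x -> pcum y <= pcum x.
Proof. by move=> yx; apply: ler_sum => t _; apply: (reach_le_ge_is okG). Qed.

(** The truncated sum still contains the increment that crosses [B]: it equals [Ptil] up to the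
    crossing and witnesses the crossing afterwards. *)
Lemma stopped_Ptil (B : R) a t : (t <= T)%N -> 1 <= B ->
  let S := \sum_(1 <= s < t.+1) (if 1 + Pt s.-1 a <= B then pinc s a else 0) in
  if 1 + Pt t a <= B then S = Pt t a else B < 1 + S.
Proof.
move=> + B1; elim: t => [|t IH] tT /=; first by rewrite big_geq//= addr0 B1.
have := IH (ltnW tT); rewrite /= [\sum_(1 <= s < t.+2) _]big_nat_recr//=.
rewrite -/(Ptil gam traj mu t.+1 a).
have P1 : Pt t a <= Pt t.+1 a by apply: (Ptil_mono okG traj gam0 muP).
case: ifPn => [h ->|h h2].
  rewrite -PtilS; case: ifPn => //; by rewrite -ltNge.
rewrite addr0; case: ifPn => // h3; move: h; rewrite -ltNge; lra.
Qed.

(** With [2 * io <= gam] the deviation is at most half the level, so the truncated sum is at most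
    [k + (1 + k)], too small to have crossed [2 * (1 + k)]. *)
Lemma one_add_Ptil_le a k : (1 <= k <= T)%N -> pcum (own a) <= k%:R ->
  1 + Pt T a <= 2 * (1 + k%:R).
Proof.
move=> kT pk; have k0 : 0 <= k%:R :> R by [].
have B1 : 1 <= 2 * (1 + k%:R) :> R by lra.
have /= := stopped_Ptil a (leqnn T) B1; case: ifPn => //= _.
set S := \sum_(1 <= s < T.+1) _ => SB.
have := pinc_conc a kT.
have : S - pcum (own a) <= \sum_(1 <= t < T.+1)
    (if 1 + Pt t.-1 a <= 2 * (1 + k%:R) then pinc t a - p t (own a) else 0).
  rewrite /S /pcum -sumrB; apply: ler_sum => t _; case: ifP => // _.
  by rewrite sub0r oppr_le0; case: (pP t).
have : io * (2 * (1 + k%:R)) / gam <= 1 + k%:R.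
  rewrite ler_pdivrMr//; have -> : io * (2 * (1 + k%:R)) = (1 + k%:R) * (2 * io) by ring.
  by rewrite ler_wpM2l// addr_ge0.
lra.
Qed.

Lemma Ltil_le a k : (1 <= k <= T)%N -> 1 + Pt T a <= 2 * (1 + k%:R) ->
  Lt T a - \sum_(1 <= t < T.+1) ell t a <= io * (2 * (1 + k%:R)) / gam.
Proof.
move=> kT PB; apply: le_trans (linc_conc a kT).
have LE t : Lt t a = \sum_(1 <= s < t.+1) linc s a.
  elim: t => [|t IH]; first by rewrite big_geq.
  by rewrite big_nat_recr//= -IH -LtilS.
rewrite LE -sumrB !big_nat; apply: ler_sum => t /andP[t0 tT].
rewrite ifT//; apply: le_trans PB; rewrite lerD2l.
apply: (Ptil_mono okG traj gam0 muP) => //.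
by apply: leq_trans (leq_pred _) _.
Qed.

Lemma exists_level x : (0 < T)%N -> exists k,
  [/\ (1 <= k <= T)%N, pcum x <= k%:R & k%:R <= 1 + pcum x].
Proof.
(* The floor plus one, capped at [T] because concentration covers only the levels up to [T]; the cap
   is harmless since [pcum x <= T]. *)
move=> T0; exists (minn T (Num.truncn (pcum x)).+1).
have /andP[tr1 tr2] := Num.Theory.truncn_itv (pcum_ge0 x).
split.
- by rewrite leq_min T0/= geq_minl.
- by rewrite /minn; case: ifP => _; [exact: pcum_le|exact: ltW].
- apply: (@le_trans _ _ (Num.truncn (pcum x)).+1%:R).
    by rewrite ler_nat geq_minr.
  by rewrite -natr1 addrC lerD2l.
Qed.

Hypothesis T0 : (0 < T)%N.

Lemma one_add_Ptil_le_pcum a : 1 + Pt T a <= 2 * (2 + pcum (own a)).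
Proof.
have [k [kT k1 k2]] := exists_level (own a) T0.
by have := one_add_Ptil_le kT k1; lra.
Qed.

Lemma one_add_Ptil_leT a : 1 + Pt T a <= 2 * (1 + T%:R).
Proof.
by apply: one_add_Ptil_le; rewrite ?T0 ?leqnn// pcum_le.
Qed.

Lemma Ltil_le_pcum a : Lt T a - \sum_(1 <= t < T.+1) ell t a <=
  2 * io / gam * (2 + pcum (own a)).
Proof.
have [k [kT k1 k2]] := exists_level (own a) T0.
apply: le_trans (Ltil_le kT (one_add_Ptil_le kT k1)) _.
have -> : 2 * io / gam * (2 + pcum (own a)) = io * (2 * (2 + pcum (own a))) / gam.
  by field; rewrite gt_eqF.
by rewrite ler_wpM2r ?invr_ge0 ?(ltW gam0)// ler_wpM2l//; lra.
Qed.

(** The additive 1 in [lam] is the base-2 logarithm of the factor 2 in the level. *)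
Lemma ln_div_ln2_le_lam (u : R) : 0 <= u -> 1 + u <= 2 * (1 + T%:R) ->
  ln (1 + u) / ln 2 <= lam.
Proof.
move=> u0 uT; have l2 : 0 < ln 2 :> R by rewrite ln_gt0// ltr1n.
have T1 : 0 < 1 + T%:R :> R by rewrite ltr_pwDl.
rewrite lamE ler_pdivrMr// mulrDl mul1r divfK ?gt_eqF//.
by rewrite -lnM ?posrE// ler_ln ?posrE ?mulr_gt0// ltr_pwDl.
Qed.

Lemma sum_Aof : \sum_(x : IX G) (Aof x)%:R = (AX G)%:R :> R.
Proof.
rewrite /AX -[RHS](sumr_const (IA G) 1) sum_own; apply: eq_bigr => x _.
by rewrite (@sum_own_const R) mulr1.
Qed.

(** For each pair, the bias is [gam] times at most the sum of relative increments of [Ptil], hence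
    logarithmic in [T]. *)
Lemma exploration_bias_le :
  \sum_(1 <= t < T.+1) \sum_a gam / (1 + Pt t.-1 a) * linc t a <=
  gam * lam * (AX G)%:R.
Proof.
rewrite exchange_big/= /AX mulr_natr -sumr_const; apply: ler_sum => a _.
apply: (@le_trans _ _ (gam * \sum_(1 <= t < T.+1)
    (Pt t a - Pt t.-1 a) / (1 + Pt t.-1 a))).
  rewrite mulr_sumr !big_nat; apply: ler_sum => -[//|t] /andP[_ tT] /=.
  have tT' : (1 <= t.+1 <= T)%N by [].
  rewrite -mulrA ler_pM2l// mulrC ler_wpM2r ?invr_ge0//.
    by rewrite addr_ge0// Ptil_ge0' // ltnW.
  rewrite addrAC subrr add0r.
  exact: (linc_le okG traj gam0 rrP muP).
rewrite ler_pM2l//; apply: le_trans (sum_increment_le_ln _ _ _) _ => //.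
- by move=> s sT; rewrite Ptil_ge0'// ltnW.
- move=> s sT; rewrite (Ptil_mono okG traj gam0 muP)//= lerD2l.
  have sT' : (1 <= s.+1 <= T)%N by [].
  apply: le_trans (pinc_le okG traj gam0 muP a sT').
  by rewrite ler_peMl// pinc_ge0'.
- by apply: ln_div_ln2_le_lam; rewrite ?Ptil_ge0' ?one_add_Ptil_leT.
Qed.

(** Bounding the rate at [x] by its own term [eta / (1 + Pbar x)] turns the losses at [x] into
    [Aof x] times the relative increment of [Pbar]. *)
Lemma sum_stab_le : \sum_(1 <= t < T.+1) stab t <= H%:R / 2 * (eta * lam * (AX G)%:R).
Proof.
rewrite /stab -mulr_sumr ler_wpM2l//.
have Pb0 := Pbar_ge0 okG traj gam0 muP.
apply: (@le_trans _ _ (\sum_(x : IX G) eta * ((Aof x)%:R * \sum_(1 <= t < T.+1)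
    (Pb t x - Pb t.-1 x) / (1 + Pb t.-1 x)))).
  rewrite (eq_bigr _ (fun t _ => sum_own _)) exchange_big/=; apply: ler_sum => x _.
  rewrite 2!mulr_sumr !big_nat; apply: ler_sum => -[//|t] /andP[_ tT] /=.
  have tT' : (1 <= t.+1 <= T)%N by [].
  have A0 : (Aof x)%:R != 0 :> R by rewrite pnatr_eq0 -lt0n (Aof_gt0 okG).
  have -> : (Aof x)%:R * ((Pb t.+1 x - Pb t x) / (1 + Pb t x)) =
      (\sum_(a | own a == x) pinc t.+1 a) / (1 + Pb t x).
    rewrite mulrA -mulrBr mulVKf// -sumrB; congr (_ / _).
    by apply: eq_bigr => a _; rewrite PtilS addrAC subrr add0r.
  rewrite mulr_suml mulr_sumr; apply: ler_sum => a /eqP ->.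
  rewrite [leLHS]mulrC [leRHS]mulrCA; apply: ler_pM.
  - exact: (linc_ge0 okG traj gam0 rrP muP).
  - by apply/ltW/(etaw_gt0 okG traj eta0 gam0 muP); exact: ltnW.
  - exact: (linc_le okG traj gam0 rrP muP).
  - exact/etaw_le/ge_is_refl.
rewrite -mulr_sumr -mulrA ler_pM2l// -sum_Aof mulr_sumr; apply: ler_sum => x _.
rewrite mulrC ler_wpM2r//; apply: le_trans (sum_increment_le_ln _ _ _) _ => //.
- by rewrite /Pbar big1 ?mulr0.
- by move=> s sT; rewrite Pb0// ltnW.
- move=> s sT; rewrite (Pbar_mono okG traj gam0 muP)//=.
  have sT' : (1 <= s.+1 <= T)%N by [].
  rewrite -[leRHS]addrC -addrA -[leRHS]addrC.
  (* Averaging [pinc <= 1 + Ptil] over the actions at [x] gives the step condition for [Pbar]. *)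
  apply: (@le_trans _ _ (Pb s x + (Aof x)%:R^-1 * \sum_(a | own a == x) (1 + Pt s a))).
    rewrite /Pbar -mulrDr -big_split/= ler_wpM2l ?invr_ge0//; apply: ler_sum => a _.
    rewrite lerD2l; apply: le_trans (pinc_le okG traj gam0 muP a sT').
    by rewrite ler_peMl// pinc_ge0'.
  rewrite big_split/= (@sum_own_const R) mulr1 mulrDr mulVf; last first.
    by rewrite pnatr_eq0 -lt0n (Aof_gt0 okG).
  by rewrite /Pbar; lra.
- apply: ln_div_ln2_le_lam; first exact: Pb0.
  rewrite -lerBrDl; apply: (Pbar_le okG) => a _.
  by rewrite lerBrDl one_add_Ptil_leT.
Qed.

Lemma sum_seqf_pcum m : is_policy m ->
  \sum_a seqf m a * (2 + pcum (own a)) <= 2 * (AX G)%:R + H%:R * T%:R.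
Proof.
move=> mP; under eq_bigr do rewrite mulrDr.
rewrite big_split/= lerD//.
  rewrite -mulr_suml mulrC ler_wpM2l// /AX -[leRHS](sumr_const (IA G) 1).
  by apply: ler_sum => a _; exact: (seqf_le1 okG).
under eq_bigr do rewrite mulr_sumr.
rewrite exchange_big/= (eq_bigr (fun=> H%:R)) => [|t _]; last first.
  exact: (sum_seqf_reach okG).
by rewrite sumr_const_nat subn1 mulr_natr.
Qed.

(** True reach probabilities decrease down the tree, so the level at [own a] bounds [Pbar] at all
    its descendants and hence the inverse rate; the log-ratio to the uniform policy is at most
    [ln (Aof x) <= io]. *)
Lemma Ddil_unif_le m : is_policy m ->
  Ddil (eW T) m (@mu_unif R G) <= 2 * io / eta * (2 * (AX G)%:R + H%:R * T%:R).
Proof.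
move=> mP; apply: le_trans (ler_wpM2l _ (sum_seqf_pcum mP)); last first.
  by rewrite divr_ge0 ?mulr_ge0// ltW.
rewrite mulr_sumr; apply: ler_sum => a _.
have Bx0 x : 0 < 2 * (2 + pcum x) by have := pcum_ge0 x; lra.
have eWge : eta / (2 * (2 + pcum (own a))) <= eW T (own a).
  apply: le_etaw => y yx; rewrite ler_pM2l// lef_pV2 ?posrE ?Bx0//; last first.
    exact: (one_add_Pbar_gt0 okG traj gam0 muP).
  apply: (@le_trans _ _ (2 * (2 + pcum y))).
    rewrite -lerBrDl; apply: (Pbar_le okG) => b <-.
    by rewrite lerBrDl one_add_Ptil_le_pcum.
  by rewrite ler_pM2l// lerD2l pcum_ge_is.
have := mP.1 a; rewrite le_eqVlt => /predU1P[ma|ma0].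
  by rewrite (seqfE okG) -ma !mul0r mulr0.
have s0 := seqf_ge0 okG a mP.
have lnle : ln (m a / @mu_unif R G a) <= io.
  apply: le_trans (Aof_io (own a)).
  rewrite /mu_unif invrK ler_ln ?posrE ?mulr_gt0 ?ltr0n ?(Aof_gt0 okG)//.
  by rewrite ler_piMl// (policy_le1 _ mP).
have eW0 : 0 < eW T (own a) by exact: (etaw_gt0 okG traj eta0 gam0 muP).
apply: (@le_trans _ _ (seqf m a / eW T (own a) * io)).
  by rewrite ler_wpM2l// divr_ge0// ltW.
have -> : 2 * io / eta * (seqf m a * (2 + pcum (own a))) =
    seqf m a / (eta / (2 * (2 + pcum (own a)))) * io.
  by field; rewrite !gt_eqF//; have := Bx0 (own a); lra.
rewrite ler_wpM2r// ler_wpM2l// lef_pV2 ?posrE//.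
by rewrite divr_gt0.
Qed.

Lemma regret_le m : is_policy m ->
  \sum_(1 <= t < T.+1) ip (fun a => seqf (mu t) a - seqf m a) (ell t) <=
  H%:R * Num.sqrt (2 * io * T%:R) + gam * lam * (AX G)%:R +
  (2 * io / gam + 2 * io / eta) * (2 * (AX G)%:R + H%:R * T%:R) +
  H%:R / 2 * (eta * lam * (AX G)%:R).
Proof.
move=> mP.
have step t : (1 <= t < T.+1)%N -> ip (fun a => seqf (mu t) a - seqf m a) (ell t) =
   (ip (seqf (mu t)) (ell t) - \sum_a ind R traj t a * (1 - rr t (depth (own a)))) +
   \sum_a gam / (1 + Pt t.-1 a) * linc t a +
   (ip (seqf (mu t)) (linc t) - stab t) - ip (seqf m) (ell t) + stab t.
  rewrite ltnS => tT.
  (* The indicator is the estimate times its denominator, so the realised loss is the estimated loss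
     of [mu t] plus the exploration bias. *)
  have -> : \sum_a ind R traj t a * (1 - rr t (depth (own a))) =
      ip (seqf (mu t)) (linc t) + \sum_a gam / (1 + Pt t.-1 a) * linc t a.
    rewrite /ip -big_split/=; apply: eq_bigr => a _.
    by rewrite -mulrDl /linc mulrA (weight_pinc okG traj gam0 muP).
  have -> : ip (fun a => seqf (mu t) a - seqf m a) (ell t) =
      ip (seqf (mu t)) (ell t) - ip (seqf m) (ell t).
    by rewrite /ip -sumrB; apply: eq_bigr => a _; rewrite mulrBl.
  ring.
rewrite (eq_big_nat _ _ step) !big_split/= sumrN.
have F := ftrl_value_ge okG H0 eta0 gam0 trajP rrP muP ftrlP (leqnn T) mP.
have L : ip (seqf m) (Lt T) - \sum_(1 <= t < T.+1) ip (seqf m) (ell t) <=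
    2 * io / gam * (2 * (AX G)%:R + H%:R * T%:R).
  apply: le_trans (ler_wpM2l _ (sum_seqf_pcum mP)); last first.
    by rewrite divr_ge0 ?mulr_ge0// ltW.
  rewrite /ip exchange_big/= -sumrB mulr_sumr; apply: ler_sum => a _.
  rewrite -mulr_sumr -mulrBr mulrCA ler_wpM2l ?(seqf_ge0 okG)//.
  exact: Ltil_le_pcum.
have := Ddil_unif_le mP; have := sum_stab_le; have := exploration_bias_le.
move: F L loss_conc; rewrite !big_split/= !sumrN mulrDl; lra.
Qed.

End Regret.

(** * Choice of the parameters *)

(** The parameters enter only through their squares. In units of [h * Z] the terms are at most 1,
    1.42, [37 / 36 * 2.42] and 1, just below 6 in total. *)
Lemma tuned_regret_sqr {R : realType} (io lam A h T eta gam Y Z : R) :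
  1 <= io -> 2 <= lam -> 1 <= A -> 1 <= h -> 36 * (io * lam * A) <= T ->
  0 < eta -> 0 < gam -> 0 <= Y -> 0 <= Z ->
  eta ^+ 2 * (lam * A) = 4 * (io * T) ->
  gam ^+ 2 * (lam * A) = 2 * h * (io * T) ->
  Y ^+ 2 = 2 * (io * T) -> Z ^+ 2 = lam * A * (io * T) ->
  6 * io <= gam /\
  h * Y + gam * lam * A + (2 * io / gam + 2 * io / eta) * (2 * A + h * T) +
  h / 2 * (eta * lam * A) <= 6 * h * Z.
Proof.
move=> io1 lam2 A1 h1 largeT e0 g0 Y0 Z0 eE gE YE ZE.
have lA : 2 <= lam * A by nra.
have lA0 : 0 < lam * A by lra.
have TA : 72 * A <= T.
  have iol : 0 <= (io - 1) * lam by rewrite mulr_ge0//; lra.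
  have : 0 <= (io * lam - 2) * A by rewrite mulr_ge0//; lra.
  by lra.
have ioT : 0 <= io * T by rewrite mulr_ge0//; lra.
have hioT : 0 <= (h - 1) * (io * T) by rewrite mulr_ge0//; lra.
split.
  rewrite -(@ler_pXn2r _ 2) ?nnegrE ?(ltW g0)//; last by lra.
  rewrite -(ler_pM2r lA0) gE.
  have : 36 * (io * lam * A) * io <= T * io by rewrite ler_wpM2r//; lra.
  by lra.
have eZ : eta * (lam * A) = 2 * Z.
  have elA0 : 0 <= eta * (lam * A) by apply: mulr_ge0; apply: ltW.
  apply/eqP; rewrite -(@eqrXn2 _ 2)//; last by lra.
  have -> : (eta * (lam * A)) ^+ 2 = eta ^+ 2 * (lam * A) * (lam * A) by ring.
  by rewrite eE exprMn ZE; apply/eqP; ring.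
(* [142 / 100] exceeds the square root of 2, and [h >= 1] replaces the square root of [h] by [h]. *)
have gZ : gam * (lam * A) <= 142 / 100 * (h * Z).
  rewrite -(@ler_pXn2r _ 2) ?nnegrE//; last 2 first.
  - by rewrite mulr_ge0// ltW.
  - by rewrite !mulr_ge0//; lra.
  have -> : (gam * (lam * A)) ^+ 2 = gam ^+ 2 * (lam * A) * (lam * A) by ring.
  rewrite gE !exprMn ZE.
  have P0 : 0 <= io * T * (lam * A) by rewrite mulr_ge0// ltW.
  have : 0 <= (h - 1) * h * (io * T * (lam * A)).
    by apply: mulr_ge0 => //; rewrite mulr_ge0//; lra.
  have : 0 <= h * h * (io * T * (lam * A)).
    by apply: mulr_ge0 => //; rewrite mulr_ge0//; lra.
  by lra.
have YZ : Y <= Z.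
  rewrite -(@ler_pXn2r _ 2) ?nnegrE// YE ZE.
  have : 0 <= (lam * A - 2) * (io * T) by rewrite mulr_ge0//; lra.
  by lra.
(* From [72 * A <= T], the term [2 * A] is at most a 36th of [h * T]. *)
have hT : 2 * A + h * T <= 37 / 36 * (h * T).
  have : 0 <= (h - 1) * T by rewrite mulr_ge0//; lra.
  by lra.
have gterm : 2 * io / gam * (h * T) = gam * (lam * A).
  apply: (mulIf (lt0r_neq0 g0)).
  have -> : gam * (lam * A) * gam = gam ^+ 2 * (lam * A) by ring.
  by rewrite gE; field; rewrite gt_eqF.
have eterm : 2 * io / eta * (h * T) = h * Z.
  apply: (mulIf (lt0r_neq0 e0)).
  have -> : h * Z * eta = h * (2 * Z) * eta / 2 by field.
  rewrite -eZ.
  have -> : h * (eta * (lam * A)) * eta / 2 = h * (eta ^+ 2 * (lam * A)) / 2 by ring.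
  by rewrite eE; field; rewrite gt_eqF.
have c0 : 0 <= 2 * io / gam + 2 * io / eta.
  by rewrite addr_ge0// divr_ge0// ?ltW//; lra.
have := ler_wpM2l c0 hT; rewrite [_ * (37 / 36 * _)]mulrCA [(_ + _) * (h * T)]mulrDl gterm eterm.
have hY : h * Y <= h * Z by rewrite ler_wpM2l//; lra.
have -> : h / 2 * (eta * lam * A) = h / 2 * (eta * (lam * A)) by ring.
rewrite eZ -[gam * lam * A]mulrA.
have : 0 <= h * Z by rewrite mulr_ge0//; lra.
by lra.
Qed.

Lemma tuned_regret {R : realType} (io lam A h T : R) :
  let eta := 2 * Num.sqrt (io * T / (lam * A)) in
  let gam := Num.sqrt (2 * io * h * T / (lam * A)) in
  1 <= io -> 2 <= lam -> 1 <= A -> 1 <= h -> 36 * (io * lam * A) <= T ->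
  6 * io <= gam /\
  h * Num.sqrt (2 * io * T) + gam * lam * A +
  (2 * io / gam + 2 * io / eta) * (2 * A + h * T) +
  h / 2 * (eta * lam * A) <= 6 * h * Num.sqrt (io * lam * A * T).
Proof.
move=> eta gam io1 lam2 A1 h1 largeT.
have lA0 : 0 < lam * A by rewrite mulr_gt0//; lra.
have ilA : 0 < io * lam * A by rewrite -mulrA mulr_gt0//; lra.
have T0 : 0 < T by lra.
have ioT : 0 < io * T by rewrite mulr_gt0//; lra.
have hioT : 0 < 2 * h * (io * T) by rewrite mulr_gt0//; lra.
have gT : 2 * io * h * T = 2 * h * (io * T) by ring.
apply: tuned_regret_sqr => //; rewrite ?sqrtr_ge0//.
- by rewrite mulr_gt0// sqrtr_gt0 divr_gt0.
- by rewrite sqrtr_gt0 divr_gt0// gT.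
- rewrite exprMn sqr_sqrtr ?divr_ge0 ?ltW//.
  by field; apply/andP; split; lra.
- by rewrite sqr_sqrtr gT ?divfK ?gt_eqF// divr_ge0// ltW.
- by rewrite sqr_sqrtr; [ring|lra].
- by rewrite sqr_sqrtr; [ring|rewrite mulr_ge0// ltW].
Qed.

Lemma trivial_regret {R : realType} (io lam A h T : R) :
  0 <= io * lam * A -> 0 <= h -> 0 <= T -> T <= 36 * (io * lam * A) ->
  h * T <= 6 * h * Num.sqrt (io * lam * A * T).
Proof.
move=> c0 h0 T0 Tc; set c := io * lam * A in c0 Tc *.
have -> : 6 * h * Num.sqrt (c * T) = h * (6 * Num.sqrt (c * T)) by ring.
rewrite ler_wpM2l//.
rewrite -(@ler_pXn2r _ 2) ?nnegrE ?mulr_ge0 ?sqrtr_ge0//.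
rewrite exprMn sqr_sqrtr; last exact: mulr_ge0.
by have := ler_wpM2r T0 Tc; lra.
Qed.

(** * Measurability and bounded expectations *)

Section SubSigmaAlgebra.
Context {d : measure_display} {Om : measurableType d} {R : realType}.
Variable F : set (set Om).
Hypothesis FS : sigma_algebra setT F.
Implicit Types f g : Om -> R.

(** A sigma-algebra generates itself, so the closure properties of measurable functions transfer to
    [Fmeas]. *)
Lemma FmeasP f : Fmeas F f <-> measurable_fun setT (f : g_sigma_algebraType F -> R).
Proof.
split=> [h _ U mU|h U mU].
  rewrite setTI /measurable/= sigma_algebra_id//; exact: h.
by have := h measurableT U mU; rewrite setTI /measurable/= sigma_algebra_id.
Qed.

Lemma Fmeas_cst (c : R) : Fmeas F (fun=> c).
Proof. apply/FmeasP; exact: measurable_cst. Qed.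

Lemma FmeasD f g : Fmeas F f -> Fmeas F g -> Fmeas F (fun w => f w + g w).
Proof. by move=> /FmeasP mf /FmeasP mg; apply/FmeasP/measurable_funD. Qed.

Lemma FmeasB f g : Fmeas F f -> Fmeas F g -> Fmeas F (fun w => f w - g w).
Proof. by move=> /FmeasP mf /FmeasP mg; apply/FmeasP/measurable_funB. Qed.

Lemma FmeasM f g : Fmeas F f -> Fmeas F g -> Fmeas F (fun w => f w * g w).
Proof. by move=> /FmeasP mf /FmeasP mg; apply/FmeasP/measurable_funM. Qed.

Lemma Fmeas_expR f : Fmeas F f -> Fmeas F (fun w => expR (f w)).
Proof. move=> /FmeasP mf; apply/FmeasP; exact: measurableT_comp. Qed.

Lemma FmeasV f : (forall w, 0 < f w) -> Fmeas F f -> Fmeas F (fun w => (f w)^-1).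
Proof.
move=> f0 /FmeasP mf.
have -> : (fun w => (f w)^-1) = (fun w => expR (- ln (f w))).
  by apply/funext => w; rewrite expRN lnK// posrE.
apply/Fmeas_expR/FmeasP/measurable_funN; apply: measurableT_comp => //.
Qed.

Lemma Fmeas_sum (I : Type) (s : seq I) (Q : pred I) (f : I -> Om -> R) :
  (forall i, Q i -> Fmeas F (f i)) -> Fmeas F (fun w => \sum_(i <- s | Q i) f i w).
Proof.
move=> mf; have -> : (fun w => \sum_(i <- s | Q i) f i w) =
    \big[(fun f g w => f w + g w)/fun=> 0]_(i <- s | Q i) f i.
  apply/funext => w; elim/big_ind2 : _ => // [? ? ? ? -> ->//].
by elim/big_ind: _ => //; [exact: Fmeas_cst|exact: FmeasD].
Qed.

Lemma Fmeas_if_le f g h (c : R) : Fmeas F f -> Fmeas F g -> Fmeas F h ->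
  Fmeas F (fun w => if f w <= c then g w else h w).
Proof.
move=> /FmeasP mf /FmeasP mg /FmeasP mh; apply/FmeasP.
by apply: measurable_fun_ifT => //; apply: measurable_fun_ler.
Qed.

Lemma Fmeas_indicator (A : set Om) (b : Om -> bool) :
  F A -> (forall w, b w <-> A w) -> Fmeas F (fun w => if b w then 1 else 0 : R).
Proof.
move=> FA bA; apply/FmeasP.
apply: measurable_fun_ifT => //=.
apply: (measurable_fun_bool true).
rewrite setTI (_ : _ @^-1` _ = A) /measurable/= ?sigma_algebra_id//.
by apply/seteqP; split=> w /= /bA.
Qed.

Lemma F_le_set f (c : R) : Fmeas F f -> F [set w | c <= f w].
Proof.
move=> mf; rewrite (_ : [set w | c <= f w] = f @^-1` `[c, +oo[).
  by apply: mf; exact: measurable_itv.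
by apply/seteqP; split=> w /=; rewrite in_itv/= andbT.
Qed.

Hypothesis Fsub : F `<=` measurable.

Lemma Fmeas_measurable f : Fmeas F f -> measurable_fun setT f.
Proof. by move=> mf _ U mU; rewrite setTI; exact/Fsub/mf. Qed.

End SubSigmaAlgebra.

Lemma Fmeas_mono {d : measure_display} {Om : measurableType d} {R : realType}
    (F F' : set (set Om)) (f : Om -> R) : F `<=` F' -> Fmeas F f -> Fmeas F' f.
Proof. by move=> FF' mf U mU; exact/FF'/mf. Qed.

Section BoundedExpectation.
Context {d : measure_display} {Om : measurableType d} {R : realType}.
Variable P : probability Om R.
Implicit Types f g X Y Z : Om -> R.

(** A class closed under sums, products and [expR], on which real-valued integrals under [P] are
    linear and monotone. *)
Definition bounded_meas f :=
  measurable_fun setT f /\ exists K : R, forall w, `|f w| <= K.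

Local Notation E f := (\int[P]_w f w).

Lemma bounded_meas_integrable f : bounded_meas f -> P.-integrable setT (EFin \o f).
Proof.
move=> [mf [K fK]]; apply: measurable_bounded_integrable => //.
  exact: le_lt_trans (probability_le1 P measurableT) (ltry _).
by exists K; split; [exact: num_real|move=> M KM w _; exact: le_trans (fK w) (ltW KM)].
Qed.

Lemma bounded_measD f g : bounded_meas f -> bounded_meas g ->
  bounded_meas (fun w => f w + g w).
Proof.
move=> [mf [K fK]] [mg [L gL]]; split; first exact: measurable_funD.
by exists (K + L) => w; apply: le_trans (ler_normD _ _) (lerD _ _).
Qed.

Lemma bounded_measM f g : bounded_meas f -> bounded_meas g ->
  bounded_meas (fun w => f w * g w).
Proof.
move=> [mf [K fK]] [mg [L gL]]; split; first exact: measurable_funM.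
by exists (K * L) => w; rewrite normrM ler_pM.
Qed.

Lemma bounded_meas_cst (c : R) : bounded_meas (fun=> c).
Proof. by split; [exact: measurable_cst|exists `|c|]. Qed.

Lemma bounded_meas_sum (I : Type) (s : seq I) (Q : pred I) (f : I -> Om -> R) :
  (forall i, Q i -> bounded_meas (f i)) ->
  bounded_meas (fun w => \sum_(i <- s | Q i) f i w).
Proof.
move=> mf; have -> : (fun w => \sum_(i <- s | Q i) f i w) =
    \big[(fun f g w => f w + g w)/fun=> 0]_(i <- s | Q i) f i.
  apply/funext => w; elim/big_ind2 : _ => // [? ? ? ? -> ->//].
by elim/big_ind: _ => //; [exact: bounded_meas_cst|exact: bounded_measD].
Qed.

Lemma bounded_meas_expR f : bounded_meas f -> bounded_meas (fun w => expR (f w)).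
Proof.
move=> [mf [K fK]]; split; first exact: measurableT_comp.
exists (expR K) => w; rewrite ger0_norm ?expR_ge0// ler_expR.
exact: le_trans (ler_norm _) (fK w).
Qed.

Lemma bounded_RintegralD f g : bounded_meas f -> bounded_meas g ->
  E (fun w => f w + g w) = E f + E g.
Proof. by move=> bf bg; rewrite RintegralD//; exact: bounded_meas_integrable. Qed.

Lemma bounded_RintegralZl (c : R) f : bounded_meas f -> E (fun w => c * f w) = c * E f.
Proof. by move=> bf; rewrite RintegralZl//; exact: bounded_meas_integrable. Qed.

Lemma Rintegral_prob_cst (c : R) : E (fun=> c) = c.
Proof.
rewrite Rintegral_cst//; transitivity (c * fine (1%E : \bar R)); last by rewrite mulr1.
congr (_ * fine _); exact: (probability_setT P).
Qed.

Lemma bounded_le_Rintegral f g : bounded_meas f -> bounded_meas g -> (forall w, f w <= g w) ->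
  E f <= E g.
Proof.
by move=> bf bg fg; apply: le_Rintegral => //; exact: bounded_meas_integrable.
Qed.

Lemma bounded_Rintegral_sum (I : Type) (s : seq I) (f : I -> Om -> R) :
  (forall i, bounded_meas (f i)) ->
  E (fun w => \sum_(i <- s) f i w) = \sum_(i <- s) E (f i).
Proof.
move=> bf; elim: s => [|i s IH].
  rewrite big_nil -[RHS](Rintegral_prob_cst 0); congr Rintegral; apply/funext => w.
  by rewrite big_nil.
rewrite big_cons -IH -bounded_RintegralD//; last exact: bounded_meas_sum.
by congr Rintegral; apply/funext => w; rewrite big_cons.
Qed.

Lemma Rintegral_indic_mul (A : set Om) f :
  E (fun w => (if `[< A w >] then 1 else 0) * f w) = \int[P]_(w in A) f w.
Proof.
rewrite [RHS]Rintegral_mkcond; congr Rintegral; apply/funext => w.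
rewrite patchE; case: asboolP => Aw.
  by rewrite mul1r mem_set.
by rewrite mul0r memNset.
Qed.

End BoundedExpectation.

(** * Conditional expectations and supermartingales *)

Lemma sum_ltn (M m : nat) : (m <= M)%N -> (\sum_(k < M) (k < m) = m)%N.
Proof.
elim: M m => [|M IH] m; first by rewrite leqn0 => /eqP ->; rewrite big_ord0.
rewrite leq_eqVlt => /predU1P[->|mM].
  rewrite (eq_bigr (fun=> 1%N)) => [|k _]; last by rewrite ltn_ord.
  by rewrite sum_nat_const card_ord muln1.
by rewrite big_ord_recr/= IH// ltnNge -ltnS mM addn0.
Qed.

(** The floor of [z] counts the positive integers not exceeding [z]. *)
Lemma truncn_layers {R : realType} (z : R) (M : nat) : 0 <= z <= M%:R ->
  \sum_(k < M) (if k.+1%:R <= z then 1 else 0) = (Num.truncn z)%:R :> R.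
Proof.
move=> /andP[z0 zM]; have /andP[t1 t2] := Num.Theory.truncn_itv z0.
have tM : (Num.truncn z <= M)%N by rewrite -(ler_nat R); exact: le_trans t1 zM.
rewrite -[in RHS](sum_ltn tM) natr_sum; apply: eq_bigr => k _.
by rewrite -Num.Theory.truncn_ge_nat//; case: ifP.
Qed.

Section PullOut.
Context {d : measure_display} {Om : measurableType d} {R : realType}.
Variable P : probability Om R.
Implicit Types f g X Y Z : Om -> R.

Local Notation E f := (\int[P]_w f w).

(** Conditional expectation tested against bounded nonnegative [F]-measurable weights instead of
    events, as needed when the weight is the exponential of the past. *)
Definition pullout (F : set (set Om)) X Y := forall Z, Fmeas F Z ->
  (exists K : R, forall w, 0 <= Z w <= K) ->
  E (fun w => Z w * X w) = E (fun w => Z w * Y w).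

Lemma norm_bounded f (K : R) : (forall w, 0 <= f w <= K) -> forall w, `|f w| <= K.
Proof. by move=> fK w; have /andP[f0 f1] := fK w; rewrite ger0_norm. Qed.

(* [Z] is approximated from below, uniformly within [1/n], by the simple
   function [floor (n Z) / n], whose level sets lie in [F]. *)
Lemma cond_exp_pullout_le (F : set (set Om)) X Y Z (C K : R) :
  sigma_algebra setT F -> F `<=` measurable ->
  measurable_fun setT X -> measurable_fun setT Y ->
  (forall w, 0 <= X w <= C) -> (forall w, 0 <= Y w <= C) ->
  cond_exp_is P F X Y -> Fmeas F Z -> (forall w, 0 <= Z w <= K) ->
  E (fun w => Z w * X w) <= E (fun w => Z w * Y w).
Proof.
move=> FS Fsub mX mY XC YC XY mZ ZK.
have bX : bounded_meas X by split=> //; exists C; exact: norm_bounded.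
have bY : bounded_meas Y by split=> //; exists C; exact: norm_bounded.
have bZ : bounded_meas Z.
  by split; [exact: Fmeas_measurable mZ|exists K; exact: norm_bounded].
apply/ler_addgt0Pr => e e0.
(* Replacing [Z] by its discretisation costs at most [C / n] on the [X] side, and this [n] makes
   that at most [e]. *)
pose n := (Num.truncn (C / e)).+1.
have n0 : 0 < n%:R :> R by [].
have Cn : C / n%:R <= e.
  rewrite ler_pdivrMr// mulrC -ler_pdivrMr//; apply: ltW.
  have C0 : 0 <= C / e.
    have /andP[X0 XC0] := XC point.
    by rewrite divr_ge0 ?(ltW e0)// (le_trans X0).
  by have /andP[_ ] := Num.Theory.truncn_itv C0.
pose M := (Num.truncn (n%:R * K)).+1.
have ZM w : 0 <= n%:R * Z w <= M%:R.
  have /andP[Z0 Z1] := ZK w; rewrite mulr_ge0//=.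
  have K0 : 0 <= n%:R * K by rewrite mulr_ge0// (le_trans Z0).
  have /andP[_ /ltW] := Num.Theory.truncn_itv K0; apply: le_trans.
  by rewrite ler_pM2l.
pose B (k : nat) := [set w | k.+1%:R / n%:R <= Z w].
have FB k : F (B k) by exact: F_le_set.
pose l (k : nat) w : R := if `[< B k w >] then 1 else 0.
pose Zn w := n%:R^-1 * \sum_(k < M) l k w.
have ZnE w : Zn w = n%:R^-1 * (Num.truncn (n%:R * Z w))%:R.
  congr (_ * _); rewrite -(truncn_layers (ZM w)); apply: eq_bigr => k _.
  have -> : (k.+1%:R <= n%:R * Z w) = (k.+1%:R / n%:R <= Z w).
    by rewrite ler_pdivrMr// mulrC.
  by rewrite /l /B /= asboolb.
have Zn1 w : Zn w <= Z w.
  rewrite ZnE [_^-1 * _]mulrC ler_pdivrMr// [Z w * _]mulrC.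
  by have /andP[z0 _] := ZM w; have /andP[] := Num.Theory.truncn_itv z0.
have Zn2 w : Z w <= Zn w + n%:R^-1.
  rewrite ZnE -[X in _ + X]mulr1 -mulrDr [_^-1 * _]mulrC ler_pdivlMr// natr1 [Z w * _]mulrC.
  by have /andP[z0 _] := ZM w; have /andP[_ /ltW] := Num.Theory.truncn_itv z0.
have bl k : bounded_meas (l k).
  split; last first.
    by exists 1 => w; rewrite /l; case: ifP; rewrite ?normr1 ?normr0.
  apply: (Fmeas_measurable Fsub); apply: Fmeas_indicator (FB k) _ => // w.
  by split=> /asboolP.
have EZn f : bounded_meas f -> E (fun w => Zn w * f w) =
    n%:R^-1 * \sum_(k < M) \int[P]_(w in B k) f w.
  move=> bf; under [X in _ = _ * X]eq_bigr do rewrite -Rintegral_indic_mul.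
  rewrite -bounded_Rintegral_sum; last by move=> k; apply: bounded_measM; first exact: bl.
  rewrite -bounded_RintegralZl; last by apply: bounded_meas_sum => k _; apply: bounded_measM; first exact: bl.
  by congr Rintegral; apply/funext => w; rewrite /Zn -mulrA mulr_suml.
have bZn : bounded_meas Zn.
  apply: bounded_measM; first exact: bounded_meas_cst.
  by apply: bounded_meas_sum => k _; exact: bl.
apply: (@le_trans _ _ (E (fun w => Zn w * X w + C / n%:R))).
  apply: bounded_le_Rintegral.
  - exact: bounded_measM.
  - by apply: bounded_measD; [exact: bounded_measM|exact: bounded_meas_cst].
  move=> w; have /andP[X0 X1] := XC w.
  have h1 : Z w * X w <= (Zn w + n%:R^-1) * X w by rewrite ler_wpM2r.
  have h2 : X w / n%:R <= C / n%:R by rewrite ler_wpM2r// invr_ge0.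
  lra.
rewrite bounded_RintegralD ?Rintegral_prob_cst; [|exact: bounded_measM|exact: bounded_meas_cst].
apply: lerD => //; rewrite EZn//.
have -> : \sum_(k < M) \int[P]_(w in B k) X w = \sum_(k < M) \int[P]_(w in B k) Y w.
  by apply: eq_bigr => k _; rewrite /Rintegral XY.
rewrite -EZn//; apply: bounded_le_Rintegral; [exact: bounded_measM|exact: bounded_measM|].
by move=> w; have /andP[Y0 _] := YC w; rewrite ler_wpM2r.
Qed.

Lemma cond_exp_pullout (F : set (set Om)) X Y (C : R) :
  sigma_algebra setT F -> F `<=` measurable ->
  measurable_fun setT X -> measurable_fun setT Y ->
  (forall w, 0 <= X w <= C) -> (forall w, 0 <= Y w <= C) ->
  cond_exp_is P F X Y -> pullout F X Y.
Proof.
move=> FS Fsub mX mY XC YC XY Z mZ [K ZK]; apply/eqP; rewrite eq_le.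
rewrite (cond_exp_pullout_le FS Fsub mX mY XC YC XY mZ ZK)/=.
apply: (cond_exp_pullout_le FS Fsub mY mX YC XC _ mZ ZK).
by move=> B FB; rewrite XY.
Qed.

Lemma pullout_sum (F : set (set Om)) (I : Type) (s : seq I) (X Y : I -> Om -> R) :
  F `<=` measurable ->
  (forall i, bounded_meas (X i)) -> (forall i, bounded_meas (Y i)) ->
  (forall i, pullout F (X i) (Y i)) ->
  pullout F (fun w => \sum_(i <- s) X i w) (fun w => \sum_(i <- s) Y i w).
Proof.
move=> Fsub bX bY XY Z mZ ZK.
have bZ : bounded_meas Z.
  split; first exact: Fmeas_measurable mZ.
  by case: ZK => K ZK; exists K; exact: norm_bounded.
have dist (W : I -> Om -> R) : (forall i, bounded_meas (W i)) ->
    E (fun w => Z w * \sum_(i <- s) W i w) = \sum_(i <- s) E (fun w => Z w * W i w).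
  move=> bW; rewrite -bounded_Rintegral_sum; last by move=> i; exact: bounded_measM.
  by congr Rintegral; apply/funext => w; rewrite mulr_sumr.
by rewrite !dist//; apply: eq_bigr => i _; exact: XY.
Qed.

Lemma pullout_compl (F : set (set Om)) X Y (c : R) :
  F `<=` measurable -> bounded_meas X -> bounded_meas Y -> pullout F X Y ->
  pullout F (fun w => c - X w) (fun w => c - Y w).
Proof.
move=> Fsub bX bY XY Z mZ ZK.
have bZ : bounded_meas Z.
  split; first exact: Fmeas_measurable mZ.
  by case: ZK => K ZK; exists K; exact: norm_bounded.
have dist W : bounded_meas W ->
    E (fun w => Z w * (c - W w)) = c * E Z + (-1) * E (fun w => Z w * W w).
  move=> bW; rewrite -!bounded_RintegralZl//; last exact: bounded_measM.
  rewrite -bounded_RintegralD; last 2 first.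
  - by apply: bounded_measM => //; exact: bounded_meas_cst.
  - by apply: bounded_measM; [exact: bounded_meas_cst|exact: bounded_measM].
  by congr Rintegral; apply/funext => w; ring.
by rewrite !dist// (XY Z mZ ZK).
Qed.

(** The weak form of the statement that [expR W] has conditional mean at most 1 given [F]. *)
Definition supermart_step (F : set (set Om)) (W : Om -> R) := forall Z, Fmeas F Z ->
  (exists K : R, forall w, 0 <= Z w <= K) ->
  E (fun w => Z w * expR (W w)) <= E Z.

(** An affine majorant of the exponential, with [F]-measurable coefficients, allows [X] to be
    replaced by its conditional mean [Y]. *)
Lemma supermart_step_affine (F : set (set Om)) (W a b X Y : Om -> R) (C : R) :
  sigma_algebra setT F -> F `<=` measurable ->
  bounded_meas W -> bounded_meas X -> bounded_meas Y -> Fmeas F a -> Fmeas F b ->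
  (forall w, 0 <= a w <= C) -> (forall w, 0 <= b w <= C) ->
  pullout F X Y ->
  (forall w, expR (W w) <= a w + b w * X w) ->
  (forall w, a w + b w * Y w <= 1) -> supermart_step F W.
Proof.
move=> FS Fsub bW bX bY ma mb aC bC XY WX WY Z mZ [K ZK].
have nb f (L : R) : Fmeas F f -> (forall w, 0 <= f w <= L) -> bounded_meas f.
  by move=> mf fL; split; [exact: Fmeas_measurable mf|exists L; exact: norm_bounded].
have bZ := nb _ _ mZ ZK; have ba := nb _ _ ma aC; have bb := nb _ _ mb bC.
have bZb : bounded_meas (fun w => Z w * b w) by exact: bounded_measM.
have bZa : bounded_meas (fun w => Z w * a w) by exact: bounded_measM.
have Z0 w : 0 <= Z w by case/andP: (ZK w).
apply: (@le_trans _ _ (E (fun w => Z w * a w + (Z w * b w) * X w))).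
  apply: bounded_le_Rintegral.
  - by apply: bounded_measM => //; exact: bounded_meas_expR.
  - by apply: bounded_measD => //; exact: bounded_measM.
  by move=> w; rewrite -mulrA -mulrDr ler_wpM2l.
rewrite bounded_RintegralD//; last exact: bounded_measM.
rewrite (XY (fun w => Z w * b w)).
- rewrite -bounded_RintegralD//; last exact: bounded_measM.
  apply: bounded_le_Rintegral => //; first by apply: bounded_measD => //; exact: bounded_measM.
  by move=> w; rewrite -mulrA -mulrDr ler_piMr.
- exact: FmeasM.
- exists (K * C) => w; have /andP[z0 zK] := ZK w; have /andP[b0 bC'] := bC w.
  by rewrite mulr_ge0//= ler_pM.
Qed.

(** The exponential of the partial sum is the test weight for the next step, so its mean stays at
    most 1; Markov's inequality gives the tail. *)
Lemma supermart_tail (F : nat -> set (set Om)) (W : nat -> Om -> R) (T : nat) (io : R) :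
  filtration F ->
  (forall t, (1 <= t <= T)%N -> [/\ Fmeas (F t) (W t), bounded_meas (W t) &
     supermart_step (F t.-1) (W t)]) ->
  F T [set w | io <= \sum_(1 <= t < T.+1) W t w] /\
  (P [set w | (io <= \sum_(1 <= t < T.+1) W t w)%R] <= (expR (- io))%:E)%E.
Proof.
move=> FF WP.
have FS t : sigma_algebra setT (F t) by case: (FF t).
have Fsub t : F t `<=` measurable by case: (FF t).
pose S t w := \sum_(1 <= s < t.+1) W s w.
have main t : (t <= T)%N -> [/\ Fmeas (F t) (S t), bounded_meas (S t) &
    E (fun w => expR (S t w)) <= 1].
  elim: t => [|t IH] tT.
    have S0 : S 0%N = fun=> 0 by apply/funext => w; rewrite /S big_geq.
    rewrite S0; split; [exact: Fmeas_cst|exact: bounded_meas_cst|].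
    by rewrite -[leRHS](Rintegral_prob_cst P) expR0.
  have [mS bS ES] := IH (ltnW tT).
  have tT' : (1 <= t.+1 <= T)%N by [].
  have [mW bW stepW] := WP _ tT'.
  have SS : S t.+1 = fun w => S t w + W t.+1 w.
    by apply/funext => w; rewrite /S big_nat_recr.
  rewrite SS; split.
  - apply: FmeasD => //; apply: Fmeas_mono mS; by case: (FF t).
  - exact: bounded_measD.
  - apply: le_trans ES; rewrite [X in Rintegral _ _ X <= _](_ : _ =
      fun w => expR (S t w) * expR (W t.+1 w)); last first.
      by apply/funext => w; rewrite expRD.
    apply: stepW; first exact: Fmeas_expR.
    have [_ [K SK]] := bS; exists (expR K) => w; rewrite expR_ge0 ler_expR.
    exact: le_trans (ler_norm _) (SK w).
have [mS bS ES] := main T (leqnn T).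
set A := [set w | _].
have FA : F T A by exact: F_le_set.
split=> //.
have mA : measurable A by exact: Fsub FA.
have : expR io * fine (P A) <= 1.
  apply: le_trans ES.
  rewrite -[fine _]mul1r -Rintegral_cst// -Rintegral_indic_mul.
  have bA : bounded_meas (fun w => (if `[< A w >] then 1 else 0) * 1 : R).
    apply: bounded_measM; last exact: bounded_meas_cst.
    split; last by exists 1 => w; case: ifP; rewrite ?normr1 ?normr0.
    apply: (Fmeas_measurable (Fsub T)); apply: Fmeas_indicator FA _ => // w.
    by split=> /asboolP.
  rewrite -bounded_RintegralZl//; apply: bounded_le_Rintegral.
  - by apply: bounded_measM => //; exact: bounded_meas_cst.
  - exact: bounded_meas_expR.
  - move=> w; case: asboolP => [Aw|_]; rewrite ?mul0r ?mulr0 ?expR_ge0//.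
    by rewrite !mulr1 ler_expR.
rewrite -ler_pdivlMl ?expR_gt0// mulr1 -expRN => h.
rewrite -[P A]fineK ?lee_fin//.
by rewrite ge0_fin_numE// (le_lt_trans (probability_le1 P mA) (ltry _)).
Qed.

End PullOut.

(** * Exponential moments *)

Section ExponentialMoments.
Context {R : realType}.

(** Since [k * X] lies in the unit interval, [expR (k * X) <= 1 + (k + k ^+ 2) * X]. The bonus
    [g >= th] absorbs the quadratic part, [(k + k ^+ 2) * q <= th], and
    [1 + th * y <= expR (th * y)] concludes. *)
Lemma ix_expR_le (th q g y X : R) :
  0 < th <= g -> 0 <= q -> 0 <= X <= 1 -> 0 <= y ->
  let k := th / (q + g) in
  [/\ 0 <= k <= 1,
    expR (th * (X / (q + g) - y)) <=
      expR (- (th * y)) + expR (- (th * y)) * (k + k ^+ 2) * X &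
    expR (- (th * y)) + expR (- (th * y)) * (k + k ^+ 2) * (q * y) <= 1].
Proof.
move=> /andP[th0 thg] q0 /andP[X0 X1] y0 k.
have qg : 0 < q + g by lra.
have k01 : 0 <= k <= 1 by rewrite divr_ge0 ?(ltW th0) ?(ltW qg)//= ler_pdivrMr//; lra.
have /andP[k0 k1] := k01.
split=> //.
  have -> : th * (X / (q + g) - y) = - (th * y) + k * X by rewrite /k; ring.
  rewrite expRD -mulrA -[X in _ <= X + _]mulr1 -mulrDr ler_wpM2l ?expR_ge0//.
  have kX : 0 <= k * X <= 1 by rewrite mulr_ge0//= mulr_ile1.
  apply: le_trans (expR_le_quadratic kX) _.
  have : (k * X) ^+ 2 <= k ^+ 2 * X.
    by rewrite exprMn ler_wpM2l ?sqr_ge0// expr2 ler_piMl.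
  lra.
have kq : (k + k ^+ 2) * q <= th.
  have -> : (k + k ^+ 2) * q = th * (q * (q + g + th) / (q + g) ^+ 2).
    by rewrite /k; field; rewrite gt_eqF.
  rewrite ler_piMr ?(ltW th0)// ler_pdivrMr ?exprn_gt0// mul1r.
  have : 0 <= q * (g - th) by rewrite mulr_ge0//; lra.
  have : 0 <= g * g by rewrite mulr_ge0//; lra.
  lra.
rewrite -mulrA -[X in X + _]mulr1 -mulrDr.
rewrite -[leRHS](expRxMexpNx_1 (th * y)) mulrC ler_wpM2r ?expR_ge0//.
apply: le_trans (expR_ge1Dx _); rewrite lerD2l mulrA.
by rewrite ler_wpM2r.
Qed.

(** A Hoeffding-type bound: the quadratic term of [expR (- (th * S))] is at most [c]. Writing it
    with [h - S] keeps the coefficient of the random term nonnegative. *)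
Lemma loss_expR_le (th h S m : R) : 0 <= th -> 0 <= h -> 0 <= S <= h ->
  let c := (th * h) ^+ 2 / 2 in
  expR (th * (m - S) - c) <=
    expR (th * m - c) * (1 - th * h + c) + expR (th * m - c) * th * (h - S) /\
  expR (th * m - c) * (1 - th * h + c) + expR (th * m - c) * th * (h - m) <= 1.
Proof.
move=> th0 h0 /andP[S0 Sh] c; split.
  have -> : th * (m - S) - c = th * m - c + - (th * S) by ring.
  rewrite expRD -mulrA -mulrDr ler_wpM2l ?expR_ge0//.
  apply: le_trans (expRN_le_quadratic _) _; first by rewrite mulr_ge0.
  have : (th * S) ^+ 2 <= (th * h) ^+ 2.
    by rewrite lerXn2r ?nnegrE ?mulr_ge0// ler_wpM2l.
  by rewrite /c; lra.
rewrite -mulrA -mulrDr; set x := th * m - c.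
have -> : 1 - th * h + c + th * (h - m) = 1 - x by rewrite /x; ring.
rewrite -[leRHS](expRxMexpNx_1 x) ler_wpM2l ?expR_ge0//.
exact: expR_ge1Dx.
Qed.

End ExponentialMoments.

(** * The two kinds of supermartingale differences *)

Section Processes.
Context {d : measure_display} {Om : measurableType d} {R : realType}.
Variable P : probability Om R.
Variables (F F' : set (set Om)).
Hypotheses (FS : sigma_algebra setT F) (F'S : sigma_algebra setT F').
Hypotheses (FF' : F `<=` F') (F'm : F' `<=` measurable).

Let Fm : F `<=` measurable. Proof. exact: subset_trans FF' F'm. Qed.

Lemma ix_supermart (X q g y u : Om -> R) (th B : R) : 0 < th ->
  Fmeas F' X -> Fmeas F q -> Fmeas F g -> Fmeas F y -> Fmeas F u ->
  (forall w, 0 <= X w <= 1) -> (forall w, 0 <= q w <= 1) -> (forall w, 0 <= y w <= 1) ->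
  (forall w, 0 < g w) -> (forall w, u w <= B -> th <= g w) ->
  cond_exp_is P F X (fun w => q w * y w) ->
  let W w := if u w <= B then th * (X w / (q w + g w) - y w) else 0 in
  [/\ Fmeas F' W, bounded_meas W & supermart_step P F W].
Proof.
move=> th0 mX mq mg my mu_ X01 q01 y01 g0 ug XY W.
have up (f : Om -> R) : Fmeas F f -> Fmeas F' f by apply: Fmeas_mono.
have qg w : 0 < q w + g w by have /andP[q0 _] := q01 w; have := g0 w; lra.
have mqgV : Fmeas F (fun w => (q w + g w)^-1).
  by apply: FmeasV => //; apply: FmeasD.
have mW : Fmeas F' W.
  apply: Fmeas_if_le => //; [exact: up| |by apply: Fmeas_cst].
  apply: FmeasM => //; first by apply: Fmeas_cst.
  by apply: FmeasB => //; [apply: FmeasM => //; exact: up|exact: up].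
have bf (f : Om -> R) : Fmeas F' f -> (forall w, 0 <= f w <= 1) -> bounded_meas f.
  by move=> mf f01; split; [exact: Fmeas_measurable mf|exists 1; exact: norm_bounded].
have bW : bounded_meas W.
  split; first exact: Fmeas_measurable mW.
  exists (1 + th) => w; rewrite /W; case: ifPn => [uB|_]; last by rewrite normr0; lra.
  have gth := ug w uB.
  have /andP[X0 X1] := X01 w; have /andP[y0 y1] := y01 w; have /andP[q0 q1] := q01 w.
  rewrite mulrBr; apply: le_trans (ler_normB _ _) _; apply: lerD.
    rewrite ger0_norm; last by rewrite !mulr_ge0 ?invr_ge0 ?(ltW th0) ?(ltW (qg w)).
    rewrite mulrA ler_pdivrMr// mul1r.
    apply: (@le_trans _ _ th); [by rewrite ler_piMr// ltW|lra].
  by rewrite ger0_norm ?mulr_ge0 ?(ltW th0)// ler_piMr// ltW.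
split=> //.
have bX := bf _ mX X01.
have bqy : bounded_meas (fun w => q w * y w).
  by apply: bounded_measM; apply: bf => //; exact: up.
have pXY : pullout P F X (fun w => q w * y w).
  apply: (cond_exp_pullout FS Fm bX.1 bqy.1 X01 _ XY) => w.
  have /andP[y0 y1] := y01 w; have /andP[q0 q1] := q01 w.
  by rewrite mulr_ge0//= mulr_ile1.
pose k w := th / (q w + g w).
have mk : Fmeas F k by apply: FmeasM => //; apply: Fmeas_cst.
have me : Fmeas F (fun w => expR (- (th * y w))).
  apply: Fmeas_expR => //.
  rewrite (_ : (fun w => _) = fun w => (- th) * y w); last first.
    by apply/funext => w; rewrite mulNr.
  by apply: FmeasM => //; apply: Fmeas_cst.
have e1 w : 0 <= expR (- (th * y w)) <= 1.
  by rewrite expR_ge0 expR_le1 oppr_le0 mulr_ge0 ?(ltW th0)//; case/andP: (y01 w).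
(* Above the level [W] is zero and the coefficients 1 and 0 make the affine bound trivial. *)
pose a w := if u w <= B then expR (- (th * y w)) else 1.
pose b w := if u w <= B then expR (- (th * y w)) * (k w + k w ^+ 2) else 0.
have key w : u w <= B -> [/\ 0 <= k w <= 1,
    expR (th * (X w / (q w + g w) - y w)) <=
      expR (- (th * y w)) + expR (- (th * y w)) * (k w + k w ^+ 2) * X w &
    expR (- (th * y w)) + expR (- (th * y w)) * (k w + k w ^+ 2) * (q w * y w) <= 1].
  move=> uB; have /andP[y0 y1] := y01 w; have /andP[q0 q1] := q01 w.
  by apply: ix_expR_le; rewrite ?th0 ?ug.
apply: (@supermart_step_affine _ _ _ P F W a b X (fun w => q w * y w) 2) => //.
- by apply: Fmeas_if_le => //; apply: Fmeas_cst.
- apply: Fmeas_if_le => //; last by apply: Fmeas_cst.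
  by apply: FmeasM => //; apply: FmeasD => //; apply: FmeasM.
- move=> w; rewrite /a; case: ifP => _; last by lra.
  by have /andP[] := e1 w; lra.
- move=> w; rewrite /b; case: ifP => [/key[/andP[k0 k1] _ _]|_]; last by lra.
  have /andP[e0 e1'] := e1 w.
  rewrite mulr_ge0 ?addr_ge0 ?sqr_ge0//=.
  have kk : k w ^+ 2 <= 1 by rewrite expr_le1.
  rewrite -[leRHS]mul1r ler_pM ?addr_ge0 ?sqr_ge0//; lra.
- by move=> w; rewrite /W /a /b; case: ifP => [/key[]//|_]; rewrite expR0 mul0r addr0.
- by move=> w; rewrite /a /b; case: ifP => [/key[]//|_]; rewrite mul0r addr0.
Qed.

Lemma loss_supermart (I : Type) (s : seq I) (X Y : I -> Om -> R) (th h : R) :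
  0 <= th -> 0 <= h ->
  (forall i, Fmeas F' (X i)) -> (forall i, Fmeas F (Y i)) ->
  (forall i w, 0 <= X i w <= 1) -> (forall i w, 0 <= Y i w <= 1) ->
  (forall w, 0 <= \sum_(i <- s) X i w <= h) -> (forall w, 0 <= \sum_(i <- s) Y i w <= h) ->
  (forall i, cond_exp_is P F (X i) (Y i)) ->
  let W w := th * (\sum_(i <- s) Y i w - \sum_(i <- s) X i w) - (th * h) ^+ 2 / 2 in
  [/\ Fmeas F' W, bounded_meas W & supermart_step P F W].
Proof.
move=> th0 h0 mX mY X01 Y01 Xh Yh XY W.
set S := fun w => \sum_(i <- s) X i w; set m := fun w => \sum_(i <- s) Y i w.
have mS : Fmeas F' S by apply: Fmeas_sum.
have mm : Fmeas F m by apply: Fmeas_sum.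
have mm' : Fmeas F' m by exact: (Fmeas_mono FF' mm).
have bf (K : R) (f : Om -> R) : Fmeas F' f -> (forall w, 0 <= f w <= K) -> bounded_meas f.
  by move=> mf f01; split; [exact: Fmeas_measurable mf|exists K; exact: norm_bounded].
have bS := bf h S mS Xh; have bm := bf h m mm' Yh.
set c := (th * h) ^+ 2 / 2.
have mW : Fmeas F' W.
  apply: FmeasB => //; last by apply: Fmeas_cst.
  by apply: FmeasM => //; [apply: Fmeas_cst|apply: FmeasB].
have bN (f : Om -> R) : bounded_meas f -> bounded_meas (fun w => - f w).
  move=> bf'; rewrite (_ : (fun w => _) = fun w => (-1) * f w).
    by apply: bounded_measM => //; exact: bounded_meas_cst.
  by apply/funext => w; rewrite mulN1r.
have bW : bounded_meas W.
  apply: bounded_measD; last exact: bounded_meas_cst.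
  apply: bounded_measM; first exact: bounded_meas_cst.
  by apply: bounded_measD => //; exact: bN.
split=> //.
have bX i : bounded_meas (X i) by apply: (bf 1).
have bY i : bounded_meas (Y i) by apply: (bf 1) => //; exact: (Fmeas_mono FF' (mY i)).
have pSm : pullout P F (fun w => h - S w) (fun w => h - m w).
  apply: pullout_compl => //; apply: pullout_sum => // i.
  exact: (cond_exp_pullout FS Fm (bX i).1 (bY i).1 (X01 i) (Y01 i) (XY i)).
have me : Fmeas F (fun w => expR (th * m w - c)).
  apply: Fmeas_expR => //; apply: FmeasB => //; last by apply: Fmeas_cst.
  by apply: FmeasM => //; apply: Fmeas_cst.
have e1 w : 0 <= expR (th * m w - c) <= expR (th * h - c).
  rewrite expR_ge0 ler_expR lerD2r ler_wpM2l//.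
  by case/andP: (Yh w).
(* This quadratic dominates [expR (- (th * h))], so the constant coefficient is nonnegative. *)
have q0 : 0 <= 1 - th * h + c.
  by have := expRN_le_quadratic (mulr_ge0 th0 h0); have := expR_gt0 (- (th * h)); rewrite /c; lra.
pose C := expR (th * h - c) * (1 - th * h + c) + expR (th * h - c) * th.
apply: (@supermart_step_affine _ _ _ P F W
  (fun w => expR (th * m w - c) * (1 - th * h + c))
  (fun w => expR (th * m w - c) * th)
  (fun w => h - S w) (fun w => h - m w) C) => //.
- by apply: bounded_measD; [exact: bounded_meas_cst|exact: bN].
- by apply: bounded_measD; [exact: bounded_meas_cst|exact: bN].
- by apply: FmeasM => //; apply: Fmeas_cst.
- by apply: FmeasM => //; apply: Fmeas_cst.
- move=> w; have /andP[e0 e1'] := e1 w; rewrite mulr_ge0//=.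
  by rewrite /C -[leLHS]addr0 lerD ?ler_wpM2r// mulr_ge0 ?expR_ge0.
- move=> w; have /andP[e0 e1'] := e1 w; rewrite mulr_ge0//=.
  by rewrite /C -[leLHS]add0r lerD ?ler_wpM2r// mulr_ge0 ?expR_ge0.
- by move=> w; have [] := @loss_expR_le R th h (S w) (m w) th0 h0 (Xh w).
- by move=> w; have [] := @loss_expR_le R th h (S w) (m w) th0 h0 (Xh w).
Qed.

End Processes.

Lemma probability_bigsetU_le {d : measure_display} {Om : measurableType d} {R : realType}
    (P : probability Om R) (I : Type) (s : seq I) (A : I -> set Om) (c : R) :
  (forall i, measurable (A i)) -> (forall i, (P (A i) <= c%:E)%E) ->
  measurable (\big[setU/set0]_(i <- s) A i) /\
  (P (\big[setU/set0]_(i <- s) A i) <= ((size s)%:R * c)%:E)%E.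
Proof.
move=> mA PA; elim: s => [|i s [mU PU]].
  by rewrite big_nil measure0 mul0r; split=> //; exact: measurable0.
rewrite big_cons; split; first exact: measurableU.
apply: le_trans (measureU2 _ (mA i) mU) _.
by rewrite /= -natr1 mulrDl mul1r addrC EFinD leeD.
Qed.

(** * Probability of the good event *)

Lemma ip_loss_bounds {R : realType} {H : nat} {G : infotree} (m : IA G -> R)
    (p : IX G -> R) (r : IA G -> R) :
  tree_ok H G -> is_policy m -> valid_reach H p -> valid_rew r ->
  0 <= ip (seqf m) (loss p r) <= H%:R.
Proof.
move=> okG mP pP rP; have [p0 _ _] := pP.
have r01 a : 0 <= 1 - r a <= 1 by have /andP[] := rP a; lra.
apply/andP; split.
  rewrite /ip sumr_ge0// => a _; have /andP[r0 r1] := r01 a.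
  by rewrite mulr_ge0 ?(seqf_ge0 okG)// mulr_ge0.
rewrite -(sum_seqf_reach okG mP pP); apply: ler_sum => a _.
have /andP[r0 r1] := r01 a.
by rewrite ler_wpM2l ?(seqf_ge0 okG)// /loss ler_piMr.
Qed.

(** * Adaptedness of the algorithm and the union bound *)

Section Protocol.
Context {R : realType} {d : measure_display} {Om : measurableType d}.
Variables (P : probability Om R) (G : infotree) (H T : nat) (gam : R)
  (N : Type) (reach : N -> IX G -> R) (rew : N -> IA G -> R)
  (F : nat -> set (set Om)) (nu : nat -> Om -> N)
  (traj : nat -> nat -> Om -> IA G) (rr : nat -> nat -> Om -> R)
  (mu : nat -> Om -> IA G -> R).
Hypothesis okG : tree_ok H G.
Hypothesis gam0 : 0 < gam.
Hypothesis valid : forall n : N, valid_reach H (reach n) /\ valid_rew (rew n).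
Hypothesis FF : filtration F.
Hypothesis obs : forall t h, (1 <= t <= T)%N -> (1 <= h <= H)%N ->
     [/\ (forall w, depth (own (traj t h w)) = h /\ 0 <= rr t h w <= 1),
         (forall a, F t [set w | traj t h w = a]) & Fmeas (F t) (rr t h)].
Hypothesis meas : forall t, (1 <= t <= T)%N ->
     [/\ (forall x, Fmeas (F t.-1) (fun w => reach (nu t w) x)),
         (forall a, Fmeas (F t.-1) (fun w => rew (nu t w) a)) &
         (forall a, Fmeas (F t.-1) (fun w => mu t w a))].
Hypothesis muP : forall t w, (1 <= t <= T)%N -> is_policy (mu t w).
Hypothesis cond : forall t, (1 <= t <= T)%N -> forall a : IA G,
     cond_exp_is P (F t.-1)
       (fun w => if traj t (depth (own a)) w == a then 1 else 0)
       (fun w => reach (nu t w) (own a) * seqf (mu t w) a) /\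
     cond_exp_is P (F t.-1)
       (fun w => (if traj t (depth (own a)) w == a then 1 else 0)
                 * (1 - rr t (depth (own a)) w))
       (fun w => seqf (mu t w) a * loss (reach (nu t w)) (rew (nu t w)) a).

Let tr w := fun s h => traj s h w.
Let Pt t a w := Ptil gam (tr w) (fun s => mu s w) t a.

(* Boolean [b] selects between the visits ([true]) and the losses ([false]). *)
Let X (b : bool) t a w : R :=
  ind R (tr w) t a * (if b then 1 else 1 - rr t (depth (own a)) w).
Let Y (b : bool) t a w : R :=
  reach (nu t w) (own a) * (if b then 1 else 1 - rew (nu t w) a).

Let FS t : sigma_algebra setT (F t). Proof. by case: (FF t). Qed.
Let Fm t : F t `<=` measurable. Proof. by case: (FF t). Qed.
Let Fup t : (1 <= t)%N -> F t.-1 `<=` F t.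
Proof. by case: t => // t _; case: (FF t). Qed.

Let depthP (a : IA G) : (1 <= depth (own a) <= H)%N.
Proof. by rewrite (depth_gt0 okG) (depth_leH okG). Qed.

Lemma Fmeas_seqf t a : (1 <= t <= T)%N -> Fmeas (F t.-1) (fun w => seqf (mu t w) a).
Proof.
move=> tT; have [_ _ mmu] := meas tT; rewrite /seqf.
move: (depth (own a)) => n; elim: n a => [|n IH] a /=; first by apply: Fmeas_cst.
apply: FmeasM => //; case: (parent (own a)) => [b|]; first exact: IH.
by apply: Fmeas_cst.
Qed.

Lemma Fmeas_ind t a : (1 <= t <= T)%N -> Fmeas (F t) (fun w => ind R (tr w) t a).
Proof.
move=> tT; have [_ Ft _] := obs tT (depthP a).
by apply: Fmeas_indicator (Ft a) _ => // w; split=> /eqP.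
Qed.

Let Pt_pos t a w : (t <= T)%N -> 0 < 1 + Pt t a w.
Proof. by move=> tT; apply: (one_add_Ptil_gt0 okG _ gam0 (fun t => @muP t w)). Qed.

Let weight_pos t a w : (1 <= t <= T)%N ->
  0 < seqf (mu t w) a + gam / (1 + Pt t.-1 a w).
Proof. by move=> tT; apply: (weight_gt0 okG _ gam0 (fun t => @muP t w)). Qed.

Lemma Fmeas_bonus t s a : (t <= T)%N ->
  Fmeas (F s) (fun w => Pt t a w) -> Fmeas (F s) (fun w => gam / (1 + Pt t a w)).
Proof.
move=> tT mP; apply: FmeasM => //; first by apply: Fmeas_cst.
apply: FmeasV => // [w|]; first exact: Pt_pos.
by apply: FmeasD => //; apply: Fmeas_cst.
Qed.

Lemma Fmeas_Ptil t a : (t <= T)%N -> Fmeas (F t) (fun w => Pt t a w).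
Proof.
elim: t => [|t IH] tT; first by apply: Fmeas_cst.
have tT' : (1 <= t.+1 <= T)%N by [].
have up (f : Om -> R) : Fmeas (F t) f -> Fmeas (F t.+1) f.
  by apply: Fmeas_mono; exact: (Fup (ltn0Sn t)).
have mP := IH (ltnW tT).
apply: FmeasD => //; first exact: up.
apply: FmeasM => //; first exact: Fmeas_ind.
apply: FmeasV => // [w|]; first exact: weight_pos.
apply: FmeasD => //; first by apply: up; exact: (Fmeas_seqf a tT').
by apply: Fmeas_bonus; [exact: ltnW|exact: up].
Qed.

Lemma Fmeas_X b t a : (1 <= t <= T)%N -> Fmeas (F t) (X b t a).
Proof.
move=> tT; apply: FmeasM => //; first exact: Fmeas_ind.
case: b; first by apply: Fmeas_cst.
have [_ _ mr] := obs tT (depthP a).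
by apply: FmeasB => //; apply: Fmeas_cst.
Qed.

Lemma Fmeas_Y b t a : (1 <= t <= T)%N -> Fmeas (F t.-1) (Y b t a).
Proof.
move=> tT; have [mp mr _] := meas tT; apply: FmeasM => //.
case: b; first by apply: Fmeas_cst.
by apply: FmeasB => //; apply: Fmeas_cst.
Qed.

Lemma X01 b t a w : (1 <= t <= T)%N -> 0 <= X b t a w <= 1.
Proof.
move=> tT; have [/(_ w)[_ /andP[r0 r1]] _ _] := obs tT (depthP a).
have i0 := @ind_ge0 R G (tr w) t a; have i1 := @ind_le1 R G (tr w) t a.
by rewrite /X; case: b; [rewrite mulr1 i0|rewrite mulr_ge0 ?mulr_ile1//; lra].
Qed.

Lemma Y01 b t a w : 0 <= Y b t a w <= 1.
Proof.
have [pP /(_ a)/andP[r0 r1]] := valid (nu t w).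
have p1 := reach_le1 okG (own a) pP; have [p0 _ _] := pP.
by rewrite /Y; case: b; [rewrite mulr1 p0|rewrite mulr_ge0 ?mulr_ile1//; lra].
Qed.

Lemma cond_exp_X b t a : (1 <= t <= T)%N ->
  cond_exp_is P (F t.-1) (X b t a) (fun w => seqf (mu t w) a * Y b t a w).
Proof.
move=> tT; have [c1 c2] := cond tT a; case: b => //.
have -> : X true t a = fun w => if traj t (depth (own a)) w == a then 1 else 0.
  by apply/funext => w; rewrite /X mulr1.
suff -> : (fun w => seqf (mu t w) a * Y true t a w) =
  fun w => reach (nu t w) (own a) * seqf (mu t w) a by [].
by apply/funext => w; rewrite /Y mulr1 mulrC.
Qed.

(** One family for the union bound: [Some (b, a, k)] is the estimate at pair [a] truncated at level
    index [k.+1], in 1..T; [None] is the realised loss. The scalings let all members share one tail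
    bound. *)
Definition deviation (th : R) (i : option (bool * IA G * 'I_T)) t w : R :=
  if i is Some (b, a, k) then
    if 1 + Pt t.-1 a w <= 2 * (1 + k.+1%:R) then
      gam / (2 * (1 + k.+1%:R)) *
      (X b t a w / (seqf (mu t w) a + gam / (1 + Pt t.-1 a w)) - Y b t a w)
    else 0
  else th * (\sum_a seqf (mu t w) a * Y false t a w - \sum_a X false t a w)
       - (th * H%:R) ^+ 2 / 2.

Lemma deviation_supermart th i t : 0 <= th -> (1 <= t <= T)%N ->
  [/\ Fmeas (F t) (deviation th i t), bounded_meas (deviation th i t) &
    supermart_step P (F t.-1) (deviation th i t)].
Proof.
move=> th0 tT; have t1 : (1 <= t)%N by case/andP: tT.
have tT1 : (t.-1 <= T)%N by case/andP: tT => _; apply: leq_trans; exact: leq_pred.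
have q01 a w : 0 <= seqf (mu t w) a <= 1.
  by rewrite (seqf_ge0 okG) ?(seqf_le1 okG)//; exact: muP.
case: i => [[[b a] k]|] /=.
  set B : R := 2 * (1 + k.+1%:R).
  have B0 : 0 < B by rewrite mulr_gt0// ltr_pwDl.
  apply: (ix_supermart (FS t.-1) (FS t) (Fup t1) (@Fm t)
    (g := fun w => gam / (1 + Pt t.-1 a w)) (u := fun w => 1 + Pt t.-1 a w) (B := B)).
  - by rewrite divr_gt0.
  - exact: Fmeas_X.
  - exact: Fmeas_seqf.
  - by apply: Fmeas_bonus => //; exact: Fmeas_Ptil.
  - exact: Fmeas_Y.
  - apply: FmeasD => //; [by apply: Fmeas_cst|exact: Fmeas_Ptil].
  - by move=> w; exact: X01.
  - exact: q01.
  - exact: Y01.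
  - by move=> w; rewrite divr_gt0// Pt_pos.
  - by move=> w uB; rewrite ler_pM2l// lef_pV2 ?posrE ?Pt_pos.
  - exact: cond_exp_X.
apply: (loss_supermart (FS t.-1) (FS t) (Fup t1) (@Fm t)
  (X := X false t) (Y := fun a w => seqf (mu t w) a * Y false t a w)) => //.
- by move=> a; exact: Fmeas_X.
- by move=> a; apply: FmeasM => //; [exact: Fmeas_seqf|exact: Fmeas_Y].
- by move=> a w; exact: X01.
- move=> a w; have /andP[q0 q1] := q01 a w; have /andP[y0 y1] := Y01 false t a w.
  by rewrite mulr_ge0//= mulr_ile1.
- move=> w; rewrite sumr_ge0 => [|a _]; last by case/andP: (X01 false a w tT).
  apply: le_trans (@sum_ind R H G okG T (tr w) _ t tT); last first.
    by move=> s h sT hH; have [/(_ w)[]] := obs sT hH.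
  apply: ler_sum => a _; rewrite /X ler_piMr ?ind_ge0//.
  by have [/(_ w)[_ /andP[r0 r1]] _ _] := obs tT (depthP a); lra.
- move=> w; have [pP rP] := valid (nu t w).
  exact: (ip_loss_bounds okG (muP w tT) pP rP).
- by move=> a; exact: cond_exp_X.
Qed.

(** There are [2 * #|IA G| * T + 1] members, each exceeding [io] with probability at most
    [expR (- io)]. *)
Lemma deviation_event th (io : R) : 0 <= th ->
  exists E : set Om, [/\ measurable E,
    ((1 - (2 * (#|IA G|%:R * T%:R) + 1) * expR (- io))%:E <= P E)%E &
    forall w, E w -> forall i, \sum_(1 <= t < T.+1) deviation th i t w <= io].
Proof.
move=> th0.
pose A i := [set w | io <= \sum_(1 <= t < T.+1) deviation th i t w].
have AP i : F T (A i) /\ (P (A i) <= (expR (- io))%:E)%E.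
  by apply: (supermart_tail io FF) => t; exact: deviation_supermart.
have mA i : measurable (A i) by apply: Fm (AP i).1.
have [mU PU] := probability_bigsetU_le (index_enum (option (bool * IA G * 'I_T)))
  mA (fun i => (AP i).2).
exists (~` \big[setU/set0]_i A i); split.
- exact: measurableC.
- rewrite probability_setC// EFinB leeB//; apply: le_trans PU _.
  rewrite lee_fin ler_wpM2r ?expR_ge0//.
  rewrite -sum1_size sum1_card card_option !card_prod card_bool card_ord.
  by rewrite -natr1 !natrM mulrA.
- move=> w Ew i; rewrite leNgt; apply/negP => /ltW Aw; apply: Ew.
  by rewrite (bigD1 i)//=; left.
Qed.

End Protocol.

(** * Assembling the good event and the deterministic regret bound *)

Unset Implicit Arguments. Set Strict Implicit. Set Printing Implicit Defensive.

Theorem theorem5 (R : realType) (d : measure_display) (Om : measurableType d)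
  (P : probability Om R) (G : infotree) (H T : nat) (delta : R)
  (N : Type) (reach : N -> IX G -> R) (rew : N -> IA G -> R)
  (F : nat -> set (set Om)) (nu : nat -> Om -> N)
  (traj : nat -> nat -> Om -> IA G) (rr : nat -> nat -> Om -> R)
  (mu : nat -> Om -> IA G -> R) :
  tree_ok H G -> (0 < H)%N -> (0 < T)%N -> 0 < delta < 1 ->
  (forall n : N, valid_reach H (reach n) /\ valid_rew (rew n)) ->
  filtration F ->
  (* observations: x^t_h in X_h, r^t_h in [0,1], adapted to F *)
  (forall t h, (1 <= t <= T)%N -> (1 <= h <= H)%N ->
     [/\ (forall w, depth (own (traj t h w)) = h /\ 0 <= rr t h w <= 1),
         (forall a, F t [set w | traj t h w = a]) & Fmeas (F t) (rr t h)]) ->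
  (* mu^t and nu^t are F_{t-1}-measurable *)
  (forall t, (1 <= t <= T)%N ->
     [/\ (forall x, Fmeas (F t.-1) (fun w => reach (nu t w) x)),
         (forall a, Fmeas (F t.-1) (fun w => rew (nu t w) a)) &
         (forall a, Fmeas (F t.-1) (fun w => mu t w a))]) ->
  let iota' := ln (3 * (AX G)%:R * T%:R / delta) in
  let lam := 1 + ln (1 + T%:R) / ln 2 in
  let eta := 2 * Num.sqrt (iota' * T%:R / (lam * (AX G)%:R)) in
  let gam := Num.sqrt (2 * iota' * H%:R * T%:R / (lam * (AX G)%:R)) in
  (* the max-player runs Adaptive-FTRL with mu^0 uniform *)
  (forall t w, (1 <= t <= T)%N ->
     ftrl_step eta gam (fun s h => traj s h w) (fun s h => rr s h w)
       (fun s => mu s w) t) ->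
  (* protocol: conditional laws given F_{t-1} *)
  (forall t, (1 <= t <= T)%N -> forall a : IA G,
     cond_exp_is P (F t.-1)
       (fun w => if traj t (depth (own a)) w == a then 1 else 0)
       (fun w => reach (nu t w) (own a) * seqf (mu t w) a) /\
     cond_exp_is P (F t.-1)
       (fun w => (if traj t (depth (own a)) w == a then 1 else 0)
                 * (1 - rr t (depth (own a)) w))
       (fun w => seqf (mu t w) a * loss (reach (nu t w)) (rew (nu t w)) a)) ->
  exists E : set Om, [/\ measurable E, ((1 - delta)%:E <= P E)%E &
    E `<=` [set w | forall mud : IA G -> R, is_policy mud ->
       \sum_(1 <= t < T.+1)
          ip (fun a => seqf (mu t w) a - seqf mud a)
             (loss (reach (nu t w)) (rew (nu t w)))
       <= 6 * H%:R * Num.sqrt (iota' * lam * (AX G)%:R * T%:R)]].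
Proof.
move=> okG H0 T0 /andP[d0 d1] valid FF obs meas iota' lam eta gam alg cond.
(* The root probabilities sum to 1, so the tree is not empty. *)
have A1 : 1 <= (AX G)%:R :> R.
  have [[_ p1 _] _] := valid (nu 1%N point).
  have [x _|noX] := pickP (fun _ : IX G => true).
    have [_ _ _ /(_ x)[a _]] := okG.
    by rewrite ler1n; apply/card_gt0P; exists a.
  by move: p1; rewrite big_pred0 => [/eqP|x]; [rewrite eq_sym oner_eq0|have := noX x].
have T1 : 1 <= T%:R :> R by rewrite ler1n.
have H1 : 1 <= H%:R :> R by rewrite ler1n.
set A : R := (AX G)%:R in A1 iota' eta gam alg *.
have AT : 1 <= A * T%:R by rewrite -[leLHS]mulr1 ler_pM.
set v := 3 * A * T%:R / delta in iota' eta gam alg *.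
have v0 : 0 < v by rewrite divr_gt0// -mulrA mulr_gt0//; lra.
have v3 : 3 * (A * T%:R) <= v.
  by rewrite mulrA ler_pdivlMr// -[leRHS]mulr1 ler_wpM2l ?(ltW d1)// -mulrA; lra.
have io1 : 1 <= iota'.
  by rewrite -ler_expR lnK// (le_trans expR1_le3)//; lra.
have lam2 : 2 <= lam.
  have l2 : 0 < ln 2 :> R by rewrite ln_gt0// ltr1n.
  have : 1 <= ln (1 + T%:R) / ln 2 :> R.
    by rewrite ler_pdivlMr// mul1r ler_ln ?posrE//; lra.
  by rewrite /lam; lra.
have muP t w : (1 <= t <= T)%N -> is_policy (mu t w) by move=> /(alg t w)[].
(* For small [T] the bound holds surely, as each episode costs at most [H]. *)
have [small|/ltW large] := leP T%:R (36 * (iota' * lam * A)).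
  exists setT; split; [exact: measurableT|by rewrite probability_setT lee_fin; lra|].
  move=> w _ mud mudP.
  apply: le_trans (trivial_regret (h := H%:R) _ _ _ small) => //; last first.
    by rewrite mulr_ge0 ?mulr_ge0//; lra.
  apply: (@le_trans _ _ (\sum_(1 <= t < T.+1) H%:R)); last first.
    by rewrite sumr_const_nat subn1 mulr_natr.
  rewrite !big_nat; apply: ler_sum => t tT.
  have [pP rP] := valid (nu t w).
  have /andP[_ b1] := ip_loss_bounds okG (muP t w tT) pP rP.
  have /andP[b2 _] := ip_loss_bounds okG mudP pP rP.
  rewrite (_ : ip _ _ = ip (seqf (mu t w)) (loss (reach (nu t w)) (rew (nu t w))) -
    ip (seqf mud) (loss (reach (nu t w)) (rew (nu t w)))); first by lra.
  by rewrite /ip -sumrB; apply: eq_bigr => a _; rewrite mulrBl.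
have [io_gam tuned] := tuned_regret io1 lam2 A1 H1 large.
rewrite -/eta -/gam in io_gam tuned.
have gam0 : 0 < gam by lra.
have eta0 : 0 < eta.
  rewrite mulr_gt0// sqrtr_gt0 divr_gt0// mulr_gt0//; lra.
set s := Num.sqrt (2 * iota' * T%:R).
have s0 : 0 < s by rewrite sqrtr_gt0 !mulr_gt0//; lra.
have sE : s ^+ 2 = 2 * iota' * T%:R by rewrite sqr_sqrtr// !mulr_ge0//; lra.
(* This tilt makes the accumulated correction [T * (th * H) ^+ 2 / 2] equal to [iota'], so the
   deviation is at most [2 * iota' / th = H * s]. *)
pose th := s / (T%:R * H%:R).
have TH0 : 0 < T%:R * H%:R :> R by rewrite mulr_gt0//; lra.
have th0 : 0 <= th by rewrite divr_ge0// ltW.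
have [E [mE PE EP]] := deviation_event okG gam0 valid FF obs meas muP cond iota' th0.
exists E; split => //.
  (* The failure probability is [(2 * A * T + 1) / v], at most [3 * A * T / v = delta] since
     [A * T >= 1]. *)
  apply: le_trans PE; rewrite lee_fin lerD2l lerN2 expRN lnK//.
  have -> : delta = 3 * A * T%:R / v.
    by rewrite /v invf_div mulrCA divff ?mulr1// gt_eqF// -mulrA mulr_gt0//; lra.
  by rewrite -/(AX G) -/A ler_wpM2r ?invr_ge0 ?(ltW v0)//; lra.
move=> w Ew mud mudP; apply: le_trans tuned.
(* The scaling [gam / B] is undone here, and [k] is shifted to the ordinal index [k - 1]. *)
have conc b a k : (1 <= k <= T)%N -> \sum_(1 <= t < T.+1)
  (if 1 + Ptil gam (fun s h => traj s h w) (fun s => mu s w) t.-1 a <= 2 * (1 + k%:R)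
   then (ind R (fun s h => traj s h w) t a *
     (if b : bool then 1 else 1 - rr t (depth (own a)) w)) /
     (seqf (mu t w) a + gam / (1 + Ptil gam (fun s h => traj s h w) (fun s => mu s w) t.-1 a))
     - reach (nu t w) (own a) * (if b then 1 else 1 - rew (nu t w) a) else 0)
  <= iota' * (2 * (1 + k%:R)) / gam.
  case: k => // k /= kT; have := EP w Ew (Some (b, a, Ordinal kT)).
  set B := 2 * (1 + k.+1%:R).
  have B0 : 0 < B by rewrite mulr_gt0// ltr_pwDl.
  rewrite /deviation /= -/B.
  rewrite (eq_bigr (fun t => gam / B * (if 1 + Ptil gam (fun s h => traj s h w)
      (fun s => mu s w) t.-1 a <= B
   then (ind R (fun s h => traj s h w) t a *
     (if b : bool then 1 else 1 - rr t (depth (own a)) w)) /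
     (seqf (mu t w) a + gam / (1 + Ptil gam (fun s h => traj s h w) (fun s => mu s w) t.-1 a))
     - reach (nu t w) (own a) * (if b then 1 else 1 - rew (nu t w) a) else 0)));
    last by move=> t _; case: ifP; rewrite ?mulr0.
  rewrite -mulr_sumr -ler_pdivlMl ?divr_gt0// invf_div => /le_trans; apply.
  by rewrite mulrC mulrA.
apply: (regret_le okG (io := iota') (lam := lam)
  (traj := fun s h => traj s h w) (rr := fun s h => rr s h w)) => //.
- by lra.
- by lra.
- by lra.
(* The chain is [Aof x <= A <= A * T <= v]. *)
- move=> x; rewrite ler_ln ?posrE ?ltr0n ?(Aof_gt0 okG)//.
  have : (Aof x)%:R <= A by rewrite ler_nat max_card.
  have : A * 1 <= A * T%:R by rewrite ler_pM2l//; lra.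
  by lra.
- by move=> t h tT hH; have [/(_ w)[dP _] _ _] := obs t h tT hH.
- by move=> t h tT hH; have [/(_ w)[_ rP] _ _] := obs t h tT hH.
- by move=> t tT; exact: alg.
- by move=> t; have [] := valid (nu t w).
- move=> a k kT; have := conc true a k kT; apply: le_trans.
  by apply: ler_sum => t _; case: ifP => // _; rewrite /pinc !mulr1.
- move=> a k kT; have := conc false a k kT; apply: le_trans.
  by apply: ler_sum => t _; case: ifP => // _; rewrite /linc /pinc [X in X - _ <= _]mulrAC.
have := EP w Ew None; rewrite /deviation /=.
rewrite sumrB -mulr_sumr sumr_const_nat subn1 /=.
set D := \sum_(1 <= t < T.+1) _.
have -> : ((th * H%:R) ^+ 2 / 2) *+ T = iota'.
  rewrite -mulr_natr /th exprMn exprMn sE.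
  by field; rewrite !gt_eqF//; lra.
have thE : th^-1 * (2 * iota') = H%:R * s.
  have -> : 2 * iota' = s ^+ 2 / T%:R by rewrite sE; field; lra.
  by rewrite /th; field; rewrite !gt_eqF//; lra.
have th_gt0 : 0 < th by rewrite /th divr_gt0.
have -> : (th * D - iota' <= iota') = (D <= th^-1 * (2 * iota')).
  by rewrite ler_pdivlMl// lerBlDr; congr (_ <= _); ring.
by rewrite thE.
Qed.
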